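(* 1) Let $\xi$ be a real algebraic number with $d=\deg\xi$, and let $L\ge 3$ be a real number with $L(\xi)\le L$. Then $$|e-\xi|\ge\exp\bigl\{-76000\, d^2(\log L+d)\bigr\}.$$ 2) Let $d\ge1$ be an integer and $L\ge3$ a real number. If $P\in\mathbb{Z}[x]$, $P\ne0$, $\deg P\le d$ and $L(P)\le L$, then $$|P(e)|\ge\exp\bigl\{-1.3\cdot10^5\, d^2(\log L+d)\bigr\}.$$
   Context: For a polynomial $P=\sum_{i=0}^d a_ix^i\in\mathbb{Z}[x]$ its length is $L(P)=\sum_{i=0}^d|a_i|$. For an algebraic number $\xi$, $L(\xi)$ denotes the length of its minimal polynomial in $\mathbb{Z}[x]$ (irreducible with coprime integer coefficients). Logarithms are natural. *)

(* Defs.v *)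
From HB Require Import structures.
From mathcomp Require Import all_boot all_order all_algebra.
From mathcomp Require Import all_classical all_reals all_analysis.

Set Implicit Arguments.
Unset Strict Implicit.
Unset Printing Implicit Defensive.

Import Order.TTheory GRing.Theory Num.Theory.
Local Open Scope ring_scope.

Definition poly_length (P : {poly int}) : int := \sum_(i < size P) `|P`_i|.

Definition intpoly_eval (R : realType) (P : {poly int}) (x : R) : R :=
  (map_poly intr P).[x].

(* On {poly int}, [irreducible_poly] means positive degree and irreducible over
   the rationals (lemma [irreducible_rat_int]): it ignores integer factors.
   [zcontents] is the gcd of the coefficients, carrying the sign of the leading
   one, so [zcontents P = 1] says that the coefficients are coprime and also
   selects one of the two polynomials P and -P, which have the same degree and
   the same length. *)
Definition is_int_minpoly (R : realType) (xi : R) (P : {poly int}) : Prop :=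
  [/\ irreducible_poly P, zcontents P = 1 & intpoly_eval P xi = 0].

(* Meaningful when xi is algebraic over the rationals, by the existence and
   uniqueness lemmas below; the default value is 0. *)
Definition int_minpoly (R : realType) (xi : R) : {poly int} :=
  xget 0 [set P | is_int_minpoly xi P]%classic.

Definition alg_degree (R : realType) (xi : R) : nat := (size (int_minpoly xi)).-1.

Definition alg_length (R : realType) (xi : R) : int := poly_length (int_minpoly xi).

Lemma is_int_minpoly_exists (R : realType) (xi : R) :
  algebraicOver (ratr : rat -> R) xi -> exists P, is_int_minpoly xi P.
Proof.
case=> p0 p0_neq0 p0_root.
have [q q_neq0 q_root] : exists2 q : {poly int}, q != 0 & intpoly_eval q xi = 0.
  have [q [a a_neq0 Dp]] := rat_poly_scale p0.
  exists q; first by apply: contraNneq p0_neq0 => q0; rewrite Dp q0 rmorph0 scaler0.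
  move/eqP: p0_root; rewrite Dp map_polyZ hornerZ => /eqP.
  rewrite mulf_eq0 fmorph_eq0 invr_eq0 intr_eq0 (negPf a_neq0) /= => /eqP.
  rewrite -map_poly_comp /intpoly_eval => <-; congr horner; apply: eq_map_poly => z /=.
  by rewrite ratr_int.
have [n] := ubnP (size q); elim: n q q_neq0 q_root => // n IHn q q_neq0 q_root lt_q_n.
have cq_neq0 : zcontents q != 0 by rewrite zcontents_eq0.
have eval_prim : intpoly_eval (zprimitive q) xi = 0.
  move/eqP: q_root; rewrite /intpoly_eval {1}[q]zpolyEprim.
  by rewrite map_polyZ hornerZ mulf_eq0 intr_eq0 (negPf cq_neq0) /= => /eqP.
have [//|no_small] := pselect (exists P, is_int_minpoly xi P).
exists (zprimitive q); split => //; last by rewrite zcontents_primitive q_neq0.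
split.
  rewrite ltnNge; apply/negP => q_le1; move/eqP: eval_prim.
  rewrite (size1_polyC q_le1) /intpoly_eval map_polyC hornerC intr_eq0 => /eqP q00.
  by move: q_neq0; rewrite -zprimitive_eq0 (size1_polyC q_le1) q00 eqxx.
move=> r r_neq1 r_dvd.
have [s Dq] := dvdpP_int r_dvd.
have qp_neq0 : zprimitive q != 0 by rewrite zprimitive_eq0.
have [r_neq0 s_neq0] : zprimitive r != 0 /\ s != 0.
  by move: qp_neq0; rewrite Dq mulf_eq0 negb_or => /andP.
have size_q : size (zprimitive q) = (size r + size s).-1.
  by rewrite Dq size_mul // size_zprimitive.
rewrite -(dvdp_size_eqp r_dvd); apply/negPn/negP => size_neq.
have r_gt0 : (0 < size r)%N by rewrite -(size_zprimitive r) size_poly_gt0.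
have s_gt0 : (0 < size s)%N by rewrite size_poly_gt0.
have le_rq : (size r <= size (zprimitive q))%N by apply: dvdp_leq.
rewrite size_zprimitive in size_q size_neq le_rq.
move: eval_prim; rewrite Dq /intpoly_eval rmorphM /= hornerM => /eqP.
rewrite mulf_eq0 => /orP[] /eqP root_f; apply: no_small.
  apply: (IHn (zprimitive r)) => //; rewrite size_zprimitive.
  apply: leq_trans (_ : size q <= n)%N; last by [].
  by rewrite ltn_neqAle size_neq.
apply: (IHn s) => //; apply: leq_trans (_ : size q <= n)%N; last by [].
rewrite size_q; case: (size r) r_gt0 r_neq1 => [|[|k]] // _ _.
by rewrite addSn /= addSn ltnS leq_addl.
Qed.

Lemma is_int_minpoly_unique (R : realType) (xi : R) (P Q : {poly int}) :
  is_int_minpoly xi P -> is_int_minpoly xi Q -> P = Q.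
Proof.
move=> [irrP cP Pxi] [irrQ cQ Qxi].
have : P %= Q.
  pose PQ := map_poly (intr : int -> rat) P; pose QQ := map_poly (intr : int -> rat) Q.
  have evalE (S : {poly int}) :
      map_poly (ratr : rat -> R) (map_poly intr S) = map_poly intr S.
    by rewrite -map_poly_comp; apply: eq_map_poly => z /=; rewrite ratr_int.
  have : ~~ coprimep PQ QQ.
    rewrite -(coprimep_map (ratr : {rmorphism rat -> R})) !evalE.
    apply/negP => /coprimep_root /(_ (_ : root _ xi)).
    by move=> /(_ (introT eqP Pxi)); rewrite -/(intpoly_eval Q xi) Qxi eqxx.
  have irrPQ : irreducible_poly PQ by apply/irreducible_rat_int.
  have irrQQ : irreducible_poly QQ by apply/irreducible_rat_int.
  have [_ dP] := irrPQ; have [_ dQ] := irrQQ.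
  rewrite /coprimep => g_neq1.
  have gP := dP _ g_neq1 (dvdp_gcdl _ _); have gQ := dQ _ g_neq1 (dvdp_gcdr _ _).
  have : PQ %= QQ by rewrite -(eqp_ltrans gP).
  by rewrite /eqp !dvdp_rat_int.
case/eqpP=> -[a b] /= /andP[a0 b0] /(congr1 zprimitive).
rewrite !zprimitiveZ // => eqPQ.
by rewrite [P]zpolyEprim [Q]zpolyEprim cP cQ eqPQ.
Qed.

Lemma int_minpolyP (R : realType) (xi : R) :
  algebraicOver (ratr : rat -> R) xi -> is_int_minpoly xi (int_minpoly xi).
Proof. by move=> /is_int_minpoly_exists; apply: xgetPex. Qed.

(* Main.v *)
Require Import Defs.
From HB Require Import structures.
From mathcomp Require Import all_boot all_order all_algebra.
From mathcomp Require Import all_classical all_reals all_analysis.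
From mathcomp Require Import all_fingroup complex.
From mathcomp Require Import zify ring lra.

(** The proof uses interpolation determinants. Suppose that xi is a root of an
    irreducible integer polynomial of degree d and length at most L, very close
    to e, and put x = ln L + d, rho = 20 x. Consider the matrix of the numbers
      e^(-js) (d/dz)^t (z^i e^(jz)) at z = s, times xi^(j s),
    with rows indexed by (s, t) and columns by (i, j).
    - It has full column rank: a polynomial in z and w = e^z vanishing at the
      points (s, xi^s) to high order along the derivation d/dz + w d/dw yields,
      through a Wronskian of its coefficients, a nonzero polynomial in z of low
      degree with many zeros. So some maximal minor is nonzero.
    - For xi = e the entries are values of derivatives of z^i e^(jz); expanding
      these functions in Taylor series at 0, the minor, of size N, only involves
      products with N distinct exponents, hence is smaller than its trivial
      bound by a factor rho^(N(N-1)/2). This survives for xi at distance at most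
      rho^(-N) from e, the difference counting as a Taylor term of order N.
    - The minor is the value at xi of an integer polynomial, and Liouville's
      inequality contradicts that smallness for a suitable choice of the ranges.
    For a polynomial P, each irreducible factor has controlled length by Landau's
    inequality on the Mahler measure; its value at e is compared with the
    distance from e to its nearest (complex) root. *)

Import Order.TTheory GRing.Theory Num.Theory.
Set Implicit Arguments.
Unset Strict Implicit.
Unset Printing Implicit Defensive.
Local Open Scope ring_scope.

(** * Zero estimate *)

(* The action of d/dz on the factor p of p e^(cz). *)
Definition twderiv (F : comNzRingType) (c : F) (p : {poly F}) : {poly F} :=
  p^`() + c *: p.

Lemma twderivD (F : comNzRingType) (c : F) : {morph twderiv c : p q / p + q}.
Proof. by move=> p q; rewrite /twderiv derivD scalerDr addrACA. Qed.

Lemma twderivZ (F : comNzRingType) (c a : F) (p : {poly F}) :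
  twderiv c (a *: p) = a *: twderiv c p.
Proof. by rewrite /twderiv derivZ scalerDr !scalerA mulrC. Qed.

Lemma twderiv0 (F : comNzRingType) (c : F) : twderiv c 0 = 0.
Proof. by rewrite /twderiv linear0 scaler0 addr0. Qed.

Lemma twderiv_sum (F : comNzRingType) (c : F) (I : Type) (r : seq I)
    (P : pred I) (f : I -> {poly F}) :
  twderiv c (\sum_(i <- r | P i) f i) = \sum_(i <- r | P i) twderiv c (f i).
Proof. exact: (big_morph _ (twderivD c) (twderiv0 c)). Qed.

Lemma twderivM (F : comNzRingType) (a b : F) (p q : {poly F}) :
  twderiv (a + b) (p * q) = twderiv a p * q + p * twderiv b q.
Proof.
by rewrite /twderiv derivM scalerDl mulrDl mulrDr -!scalerAl -!scalerAr addrACA.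
Qed.

Lemma iter_twderivZ (F : comNzRingType) (c a : F) n p :
  iter n (twderiv c) (a *: p) = a *: iter n (twderiv c) p.
Proof. by elim: n => //= n ->; rewrite twderivZ. Qed.

Lemma iter_twderiv_sum (F : comNzRingType) (c : F) n (I : Type) (r : seq I)
    (P : pred I) (f : I -> {poly F}) :
  iter n (twderiv c) (\sum_(i <- r | P i) f i)
  = \sum_(i <- r | P i) iter n (twderiv c) (f i).
Proof. by elim: n => //= n ->; rewrite twderiv_sum. Qed.

Lemma twderiv_prod (F : comNzRingType) (I : eqType) (r : seq I) (c : I -> F)
    (f : I -> {poly F}) : uniq r ->
  twderiv (\sum_(i <- r) c i) (\prod_(i <- r) f i)
  = \sum_(k <- r) \prod_(i <- r) iter (i == k) (twderiv (c i)) (f i).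
Proof.
elim: r => [_|x r IH /= /andP[xr ur]].
  by rewrite !big_nil /twderiv scale0r addr0 derivC.
rewrite !big_cons twderivM IH // eqxx /=; congr (_ + _).
  congr (_ * _); rewrite !big_seq; apply: eq_bigr => i ir.
  by case: eqP ir xr => // -> ->.
rewrite big_distrr /= !big_seq; apply: eq_bigr => k kr.
by rewrite big_cons; case: eqP kr xr => // -> ->.
Qed.

(** Each application of [twderiv c] lowers the order at [s] by one and multiplies the value at [s]
    of the cofactor by the old order. *)
Lemma horner_iter_twderiv_XsubC (F : comNzRingType) (c s : F) m (q : {poly F}) :
  (iter m (twderiv c) (('X - s%:P) ^+ m * q)).[s] = m`!%:R * q.[s].
Proof.
elim: m q => [|m IH] q; first by rewrite expr0 mul1r fact0 mul1r.
rewrite iterSr.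
have -> : twderiv c (('X - s%:P) ^+ m.+1 * q)
   = ('X - s%:P) ^+ m * (m.+1%:R *: q + ('X - s%:P) * twderiv c q).
  rewrite -[X in twderiv X]add0r twderivM {1}/twderiv scale0r addr0.
  rewrite deriv_exp derivXsubC mul1r /= -scaler_nat -!mul_polyC exprS.
  by rewrite add0r; ring.
rewrite IH hornerD hornerZ hornerM hornerXsubC subrr mul0r addr0 mulrA -natrM.
by rewrite mulnC -factS.
Qed.

(** A root of exact order [m < n] would make the [m]-th twisted derivative at [s] equal to m! times
    a nonzero value, which is nonzero in characteristic 0. *)
Lemma dvdp_XsubC_twderiv (F : numFieldType) (c s : F) n (p : {poly F}) :
  (forall m, (m < n)%N -> (iter m (twderiv c) p).[s] = 0) ->
  ('X - s%:P) ^+ n %| p.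
Proof.
move=> ps; have [m [q qs pE]] := multiplicity_XsubC p s.
have [->|p0] := eqVneq p 0; first exact: dvdp0.
have [nm|mn] := leqP n m.
  by rewrite pE; apply: dvdp_mull; apply: dvdp_exp2l.
have := ps m mn; rewrite pE mulrC horner_iter_twderiv_XsubC => /eqP.
rewrite mulf_eq0 pnatr_eq0 -leqn0 leqNgt fact_gt0 /=.
by move: qs; rewrite p0 /= => /negbTE; rewrite /root => ->.
Qed.

Lemma mulr_signZ (F : comNzRingType) (b : bool) (p : {poly F}) :
  (-1) ^+ b * p = (-1) ^+ b *: p.
Proof. by case: b; rewrite ?expr0 ?expr1 ?mul1r ?scale1r // mulN1r scaleN1r. Qed.

(** For [r k = k] this is the Wronskian matrix of the functions a_j e^(c_j z), the exponentials
    being taken out of the columns. Arbitrary row orders make the family stable under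
    differentiation. *)
Definition twmx (F : comNzRingType) m (c : 'I_m -> F) (a : 'I_m -> {poly F})
    (r : 'I_m -> nat) : 'M[{poly F}]_m :=
  \matrix_(k, j) iter (r k) (twderiv (c j)) (a j).

(** Every permutation picks each column once, so all terms of the expansion carry the same twist,
    the sum of the [c j], and the product rule applies term by term. *)
Lemma twderiv_det (F : comNzRingType) m (c : 'I_m -> F) a (r : 'I_m -> nat) :
  twderiv (\sum_j c j) (\det (twmx c a r))
  = \sum_k \det (twmx c a (fun i => (i == k) + r i)%N).
Proof.
rewrite /determinant twderiv_sum exchange_big /=; apply: eq_bigr => s _.
have -> : \sum_j c j = \sum_j c (s j) by rewrite (reindex_inj (@perm_inj _ s)).
rewrite -!mulr_sumr !mulr_signZ.
rewrite twderivZ twderiv_prod ?index_enum_uniq //; congr (_ *: _).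
apply: eq_bigr => k _; apply: eq_bigr => i _; rewrite !mxE.
by rewrite iterD.
Qed.

(* (d/dz + sum_j c j) acts on the determinant by raising the order of one row
   at a time, and any matrix whose rows have orders below T becomes singular
   at s, with kernel vector y. *)
Lemma twderiv_det_vanish (F : comNzRingType) m (c : 'I_m -> F) a (s : F)
    (y : 'I_m -> F) T n (r : 'I_m -> nat) :
    (forall t, (t < T)%N -> \sum_j (iter t (twderiv (c j)) (a j)).[s] * y j = 0) ->
    (exists j, GRing.lreg (y j)) -> (forall k, r k + n < T)%N ->
  (iter n (twderiv (\sum_j c j)) (\det (twmx c a r))).[s] = 0.
Proof.
move=> ay0 [j0 yj0]; elim: n r => [|n IH] r rT; last first.
  rewrite iterSr twderiv_det iter_twderiv_sum horner_sum big1 // => k _.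
  by apply: IH => i; have := rT i; case: (i == k) => /=; lia.
rewrite /= -[_.[s]]/(horner_eval s _) -det_map_mx.
set A := map_mx _ _; pose v := \col_j y j.
have Av : A *m v = 0.
  apply/matrixP => i j; rewrite !mxE -[RHS](ay0 (r i)) //; last by have := rT i; lia.
  by apply: eq_bigr => k _; rewrite !mxE.
have : \det A *: v = 0 by rewrite -mul_scalar_mx -mul_adj_mx -mulmxA Av mulmx0.
move=> /matrixP/(_ j0 ord0); rewrite !mxE mulrC => h.
by apply: yj0; rewrite h mulr0.
Qed.

Lemma size_twderiv (F : comNzRingType) (c : F) n (p : {poly F}) :
  (size (iter n (twderiv c) p) <= size p)%N.
Proof.
elim: n => //= n IH; apply: leq_trans (size_polyD _ _) _.
rewrite geq_max (leq_trans (size_scale_leq _ _) IH) andbT.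
apply: leq_trans IH; apply: leq_trans (leq_pred _).
apply/leq_sizeP => i hi; rewrite coef_deriv; set p' := iter _ _ _ in hi *.
by rewrite nth_default ?mul0rn // ; case: (size p') hi.
Qed.

(** Differentiation lowers the degree, so only the multiplication by [c] reaches the top
    coefficient. *)
Lemma lead_twderiv (F : comNzRingType) (c : F) n (p : {poly F}) :
  (iter n (twderiv c) p)`_(size p).-1 = c ^+ n * lead_coef p.
Proof.
elim: n => [|n IH] /=; first by rewrite expr0 mul1r lead_coefE.
rewrite coefD coef_deriv coefZ IH exprS mulrA nth_default ?mul0rn ?add0r //.
by apply: leq_trans (size_twderiv _ _ _) _; exact: leqSpred.
Qed.

Lemma coef_prod_top (F : comNzRingType) (I : Type) (r : seq I)
    (f : I -> {poly F}) (n : I -> nat) :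
    (forall i, size (f i) <= (n i).+1)%N ->
  (size (\prod_(i <- r) f i)%R <= (\sum_(i <- r) n i).+1)%N
  /\ (\prod_(i <- r) f i)`_(\sum_(i <- r) n i)%N = \prod_(i <- r) (f i)`_(n i).
Proof.
move=> hf; elim: r => [|x r [IH1 IH2]]; first by rewrite !big_nil size_poly1 coefC.
rewrite !big_cons; split.
  apply: leq_trans (size_polyMleq _ _) _; have := hf x; lia.
rewrite -IH2 coefM; set Q := \prod_(i <- r) f i; set N := (\sum_(i <- r) n i)%N.
have hx : (n x < (n x + N).+1)%N by lia.
rewrite (bigD1 (Ordinal hx)) //= addKn big1 ?addr0 // => i ne.
have {}ne : (i : nat) <> n x by move=> e; case/eqP: ne; exact: val_inj.
have [lt|ge] := ltnP i (n x).
  by rewrite [Q`__]nth_default ?mulr0 //; apply: leq_trans IH1 _; rewrite -/N; lia.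
by rewrite [(f x)`__]nth_default ?mul0r //; apply: leq_trans (hf x) _; lia.
Qed.

(** Row k contributes c_j^k to the top coefficients, so the coefficient in degree sum_j deg a_j is
    the product of the leading coefficients times a Vandermonde determinant in the distinct
    [c j]. *)
Lemma twdet_neq0 (F : idomainType) m (c : 'I_m -> F) (a : 'I_m -> {poly F}) :
    injective c -> (forall j, a j != 0) ->
  \det (twmx c a (fun k => k)) != 0
  /\ (size (\det (twmx c a (fun k => k))) <= (\sum_j (size (a j)).-1).+1)%N.
Proof.
move=> cinj a0; rewrite -det_tr; pose n j := (size (a j)).-1.
set W := \det _; split; last first.
  rewrite /W /determinant; apply: leq_trans (size_sum _ _ _) _.
  apply/bigmax_leqP => s _.
  have [|h _] := @coef_prod_top F _ (index_enum 'I_m)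
     (fun i => iter (s i) (twderiv (c i)) (a i)) n.
    by move=> i; apply: leq_trans (size_twderiv _ _ _) _; exact: leqSpred.
  rewrite (eq_bigr (fun i => iter (s i) (twderiv (c i)) (a i))); last first.
    by move=> i _; rewrite !mxE.
  by rewrite mulr_signZ; apply: leq_trans (size_scale_leq _ _) h.
have WE : W`_(\sum_j n j)%N = (\prod_j lead_coef (a j)) * \det (Vandermonde m (\row_j c j)).
  rewrite -[in RHS]det_tr /W /determinant coef_sum mulr_sumr; apply: eq_bigr => s _.
  rewrite (eq_bigr (fun i => iter (s i) (twderiv (c i)) (a i))); last first.
    by move=> i _; rewrite !mxE.
  rewrite mulr_signZ coefZ.
  have [|_ ->] := @coef_prod_top F _ (index_enum 'I_m)
     (fun i => iter (s i) (twderiv (c i)) (a i)) n.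
    by move=> i; apply: leq_trans (size_twderiv _ _ _) _; exact: leqSpred.
  rewrite mulrCA; congr (_ * _); rewrite -big_split /=; apply: eq_bigr => i _.
  by rewrite lead_twderiv !mxE mulrC.
apply/eqP => W0; move/eqP: WE; rewrite W0 coef0 eq_sym mulf_eq0.
rewrite det_Vandermonde => /orP[] /prodf_eq0[j _].
  by rewrite lead_coef_eq0 (negbTE (a0 j)).
move=> /prodf_eq0[k jk]; rewrite !mxE subr_eq0 => /eqP/cinj kj.
by rewrite kj ltnn in jk.
Qed.

Lemma dvdp_prod_XsubC_exp (F : numFieldType) n S (p : {poly F}) :
    (forall s, (s < S)%N -> ('X - s%:R%:P) ^+ n %| p) ->
  \prod_(s < S) ('X - s%:R%:P) ^+ n %| p.
Proof.
elim: S => [|S IH] h; first by rewrite big_ord0 dvd1p.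
rewrite big_ord_recr /= Gauss_dvdp.
  by rewrite h // andbT; apply: IH => s sS; apply: h; lia.
apply: (big_ind (fun q => coprimep q _)) => [|p1 p2 h1 h2|s _].
- exact: coprime1p.
- by rewrite coprimepMl h1.
apply/coprimep_expl/coprimep_expr; rewrite coprimep_XsubC root_XsubC eqr_nat.
by have := ltn_ord s; lia.
Qed.

(** The Wronskian is nonzero of degree at most m M. As its rows already use up to m - 1 derivatives,
    it vanishes to order at least T - (m - 1) at each of the points 0, ..., S - 1. *)
Lemma twderiv_zero_estimate (F : numFieldType) m M S T (c : 'I_m -> F)
    (a : 'I_m -> {poly F}) (y : nat -> 'I_m -> F) :
    injective c -> (forall j, a j != 0) -> (forall j, size (a j) <= M.+1)%N ->
    (0 < m)%N -> (forall s j, y s j != 0) ->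
    (forall s t, (s < S)%N -> (t < T)%N ->
      \sum_j (iter t (twderiv (c j)) (a j)).[s%:R] * y s j = 0) ->
  (S * (T - m.-1) <= m * M)%N.
Proof.
move=> cinj a0 aM m0 y0 hz.
have [W0 sW] := twdet_neq0 cinj a0; set W := \det _ in W0 sW.
have : \prod_(s < S) ('X - s%:R%:P) ^+ (T - m.-1) %| W.
  apply: dvdp_prod_XsubC_exp => s sS.
  apply: (@dvdp_XsubC_twderiv _ (\sum_j c j)) => n nT.
  apply: (@twderiv_det_vanish _ _ _ _ _ (y s) T) => [t tT||k]; first exact: hz.
    by exists (Ordinal m0); apply/lregP.
  by have := ltn_ord k; lia.
move=> /dvdp_leq -/(_ W0); rewrite size_prod; last first.
  by move=> s _; rewrite expf_neq0 // polyXsubC_eq0.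
rewrite (eq_bigr (fun=> (T - m.-1).+1)); last by move=> s _; rewrite size_exp_XsubC.
rewrite sum_nat_const card_ord => h.
have le_sum : (\sum_j (size (a j)).-1 <= m * M)%N.
  apply: leq_trans (_ : \sum_(j < m) M <= _)%N; last by rewrite sum_nat_const card_ord.
  by apply: leq_sum => j _; have := aM j; lia.
move: le_sum (leq_trans h sW); rewrite mulnS.
set X := (\sum_j _)%N; set Y := (S * _)%N; set Z := (m * M)%N; lia.
Qed.

(** * The interpolation matrix and its rank *)

Lemma iter_twderivE (F : comNzRingType) (c : F) t (p : {poly F}) :
  iter t (twderiv c) p = \sum_(k < t.+1) ('C(t, k)%:R * c ^+ (t - k)) *: p^`(k).
Proof.
elim: t => [|t IH]; first by rewrite big_ord1 bin0 mul1r scale1r.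
rewrite iterS IH /twderiv linear_sum scaler_sumr /=.
rewrite [RHS]big_ord_recl bin0 mul1r subn0.
under [in RHS]eq_bigr => k _.
  rewrite /= /bump leq0n add1n binS subSS natrD mulrDl scalerDl; over.
rewrite big_split /= addrA addrC; congr (_ + _).
  by apply: eq_bigr => k _; rewrite derivZ.
rewrite [LHS]big_ord_recl bin0 mul1r subn0 scalerA -exprS; congr (_ + _).
rewrite [RHS]big_ord_recr /= bin_small // mul0r scale0r addr0.
apply: eq_bigr => k _; rewrite /= /bump leq0n add1n scalerA mulrCA -exprS.
by congr ((_ * c ^+ _) *: _); have := ltn_ord k; lia.
Qed.

(* The value at s of (d/dz + j)^t z^i, that is e^(-js) (d/dz)^t (z^i e^(jz)). *)
Definition taylor_coef (s t i j : nat) : nat :=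
  \sum_(k < t.+1) 'C(t, k) * i ^_ k * s ^ (i - k) * j ^ (t - k).

Lemma taylor_coefE (F : comNzRingType) (s t i j : nat) :
  (iter t (twderiv j%:R) 'X^i).[s%:R] = (taylor_coef s t i j)%:R :> F.
Proof.
rewrite iter_twderivE horner_sum natr_sum; apply: eq_bigr => k _.
rewrite hornerZ derivnXn hornerMn hornerXn !natrM !natrX.
by rewrite -[_ *+ _ ^_ _]mulr_natl; ring.
Qed.

Lemma sum_ord_mul (V : nmodType) (M J : nat) (f : nat -> V) :
  \sum_(l < M * J) f l = \sum_(i < M) \sum_(j < J) f (i * J + j)%N.
Proof.
elim: M => [|M IH]; first by rewrite !big_ord0.
rewrite big_ord_recr /= -IH mulSn addnC big_split_ord /=.
by congr (_ + _); apply: eq_bigr => j _; rewrite addnC.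
Qed.

(* Row s * T + t and column i * J + j. *)
Definition interp_mx (F : fieldType) (xi : F) (S T M J : nat) : 'M[F]_(S * T, M * J) :=
  \matrix_(m, l) ((taylor_coef (m %/ T) (m %% T) (l %/ J) (l %% J))%:R
                  * xi ^+ (l %% J * (m %/ T))).

(** A kernel vector holds the coefficients of a polynomial sum_j a_j(z) w^j vanishing at the points
    (s, xi^s). The zero estimate applies to the nonzero a_j, whose number m is not known in advance,
    hence a hypothesis for every m up to [J]. *)
Lemma interp_mx_full (F : numFieldType) (xi : F) (S T M J : nat) :
    xi != 0 -> (forall m, 0 < m -> m <= J -> m * M.-1 < S * (T - m.-1))%N ->
  row_full (interp_mx xi S T M J).
Proof.
move=> xi0 hST; rewrite /row_full -mxrank_tr.
apply: inj_row_free => v vA; apply/rowP => l0; rewrite mxE.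
have /andP[M0 J0] : (0 < M)%N && (0 < J)%N.
  by rewrite -muln_gt0; apply: leq_ltn_trans (ltn_ord l0).
(* Extension of [v] by 0 to all naturals, so that its entries can be addressed as [i * J + j]. *)
pose vn n := oapp (v 0) 0 (insub n : option 'I_(M * J)).
have vnE (l : 'I_(M * J)) : vn l = v 0 l by rewrite /vn valK.
pose a (j : nat) := \poly_(i < M) vn (i * J + j)%N.
have aE j : a j = \sum_(i < M) vn (i * J + j)%N *: 'X^i by rewrite /a poly_def.
suff a0 (j : 'I_J) : a j = 0.
  have jlt : (l0 %% J < J)%N by rewrite ltn_mod.
  have := congr1 (fun p : {poly F} => p`_(l0 %/ J)) (a0 (Ordinal jlt)).
  rewrite coef_poly coef0 ltn_divLR // ltn_ord /= -divn_eq.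
  by rewrite vnE.
apply/eqP; apply: contraT => aj0.
pose A := [set j : 'I_J | a j != 0].
have m0 : (0 < #|A|)%N by apply/card_gt0P; exists j; rewrite inE.
have mJ : (#|A| <= J)%N by rewrite -[X in (_ <= X)%N]card_ord max_card.
have := hST _ m0 mJ; rewrite ltnNge => /negP; case.
pose e (k : 'I_#|A|) := enum_val k.
apply: (@twderiv_zero_estimate F #|A| M.-1 S T (fun k => (e k)%:R)
  (fun k => a (e k)) (fun s k => xi ^+ (e k * s))) => //.
- by move=> k k' /eqP; rewrite eqr_nat => /eqP/val_inj/enum_val_inj.
- by move=> k; have := enum_valP k; rewrite inE.
- by move=> k; rewrite prednK // size_poly.
- by move=> s k; rewrite expf_neq0.
move=> s t sS tT.
have mlt : (s * T + t < S * T)%N by nia.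
have T0 : (0 < T)%N by lia.
have := congr1 (fun B : 'rV_(S * T) => B 0 (Ordinal mlt)) vA; rewrite !mxE.
under eq_bigr do rewrite !mxE /= divnMDl // modnMDl (divn_small tT) (modn_small tT) addn0 -vnE.
rewrite (sum_ord_mul _ _ (fun l => vn l * ((taylor_coef s t (l %/ J) (l %% J))%:R
  * xi ^+ (l %% J * s)))) exchange_big /= => vA0; rewrite -[RHS]vA0.
pose G (j : 'I_J) := (iter t (twderiv j%:R) (a j)).[s%:R] * xi ^+ (j * s).
rewrite -[LHS]/(\sum_(k < #|A|) G (enum_val k)) -(big_enum_val G) /=.
rewrite [RHS](bigID (mem A)) /= [X in _ = _ + X]big1 ?addr0; last first.
  move=> k; rewrite inE negbK => /eqP ak0; apply: big1 => i _.
  have ilt : (i * J + k < M * J)%N by have := ltn_ord i; have := ltn_ord k; nia.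
  have := congr1 (fun p : {poly F} => p`_i) ak0; rewrite coef_poly coef0 ltn_ord => ->.
  by rewrite mul0r.
apply: eq_bigr => k _.
rewrite /G aE iter_twderiv_sum horner_sum mulr_suml; apply: eq_bigr => i _.
rewrite iter_twderivZ hornerZ taylor_coefE divnMDl // modnMDl.
by rewrite (divn_small (ltn_ord k)) (modn_small (ltn_ord k)) addn0 mulrA.
Qed.

(** * Upper bound for interpolation determinants *)

Lemma big_option (V : nmodType) (I : finType) (f : option I -> V) :
  \sum_o f o = f None + \sum_i f (Some i).
Proof.
rewrite (bigD1 None) //=; congr (_ + _).
rewrite (reindex_omap Some id) /=; last by case.
by apply: eq_bigl => i; rewrite eqxx.
Qed.

(** [None] stands for the error term, which counts as a Taylor term of order [N]. *)
Definition capped_weight N (o : option 'I_N) : nat := oapp (@nat_of_ord N) N o.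

(** The deficits [N - capped_weight] vanish on [None] and are otherwise N - n for distinct n, so
    they sum to at most the sum of all N - n with n < N. *)
Lemma sum_capped_weight N (phi : 'I_N -> option 'I_N) :
    (forall m m' n, phi m = Some n -> phi m' = Some n -> m = m') ->
  ('C(N, 2) <= \sum_m capped_weight (phi m))%N.
Proof.
move=> inj; suff : (\sum_m (N - capped_weight (phi m)) <= \sum_(n < N) (N - n))%N.
  have wN m : (capped_weight (phi m) <= N)%N.
    by case: (phi m) => //= n; exact: ltnW.
  rewrite !sumnB; [|by move=> i _; rewrite ltnW|by []].
  rewrite sum_nat_const card_ord -bin2_sum big_mkord.
  have : (\sum_(m < N) capped_weight (phi m) <= N * N)%N.
    by rewrite -[X in (_ <= X * _)%N](card_ord N) -sum_nat_const; apply: leq_sum.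
  have : (\sum_(i < N) i <= N * N)%N.
    rewrite -[X in (_ <= X * _)%N](card_ord N) -sum_nat_const.
    by apply: leq_sum => i _; exact: ltnW.
  by set X := (\sum_(i < N) i)%N; set Y := (\sum_(m < N) _)%N; lia.
have E m : (N - capped_weight (phi m) = \sum_(n < N | phi m == Some n) (N - n))%N.
  case: (phi m) => [n|] /=; last by rewrite subnn big_pred0.
  by rewrite (big_pred1 n) // => i /=; rewrite eq_sym.
rewrite (eq_bigr _ (fun m _ => E m)).
rewrite (exchange_big_dep xpredT) //=; apply: leq_sum => n _.
case: (pickP (fun m => phi m == Some n)) => [m /eqP pm|none]; last by rewrite big_pred0.
rewrite (big_pred1 m) // => m' /=; apply/eqP/eqP => [h|->//].
exact: inj h pm.
Qed.

(* Expanding the rows of the sum over n < N and the error term R, only the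
   choices using each n at most once survive, and an error term counts for N:
   every surviving product carries at least N(N-1)/2 factors 1/rho. *)
Lemma interp_det_bound (F : numFieldType) N (v u : 'I_N -> 'I_N -> F)
    (R : 'M[F]_N) (rho B : F) :
    1 <= rho ->
    (forall m l, \sum_n `|v n m * u n l| * rho ^+ n + `|R m l| * rho ^+ N <= B) ->
  `|\det (\matrix_(m, l) (\sum_n v n m * u n l + R m l))| * rho ^+ 'C(N, 2)
  <= N`!%:R * B ^+ N.
Proof.
move=> rho1 hB; have rho0 : 0 <= rho := le_trans ler01 rho1.
pose term (o : option 'I_N) m l := if o is Some n then v n m * u n l else R m l.
pose D (phi : {ffun 'I_N -> option 'I_N}) := \matrix_(m, l) term (phi m) m l.
have -> : \det (\matrix_(m, l) (\sum_n v n m * u n l + R m l)) = \sum_phi \det (D phi).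
  rewrite /determinant exchange_big /=; apply: eq_bigr => s _.
  rewrite -mulr_sumr; congr (_ * _).
  rewrite (eq_bigr (fun m => \sum_o term o m (s m))); last first.
    by move=> m _; rewrite mxE big_option /= addrC.
  rewrite bigA_distr_bigA /=; apply: eq_bigr => phi _.
  by apply: eq_bigr => m _; rewrite mxE.
pose w m l o := `|term o m l| * rho ^+ capped_weight o.
have w0 m l o : 0 <= w m l o by rewrite mulr_ge0 ?exprn_ge0.
apply: (@le_trans _ _ (\sum_(phi : {ffun _ -> _}) \sum_(s : 'S_N) \prod_m w m (s m) (phi m))).
  apply: le_trans (ler_wpM2r (exprn_ge0 _ rho0) (ler_norm_sum _ _ _)) _.
  rewrite mulr_suml; apply: ler_sum => phi _.
  have [->|D0] := eqVneq (\det (D phi)) 0.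
    by rewrite normr0 mul0r; apply: sumr_ge0 => s _; exact: prodr_ge0.
  (* If two rows use the same n, the matrix is a diagonal matrix times one with two equal rows, and
     its determinant is 0. *)
  have phi_inj m m' n : phi m = Some n -> phi m' = Some n -> m = m'.
    move=> pm pm'; apply/eqP; apply: contraNT D0 => mm'.
    pose d := \row_m if phi m is Some n then v n m else 1.
    pose U := \matrix_(m, l) if phi m is Some n then u n l else R m l.
    have -> : D phi = diag_mx d *m U.
      apply/matrixP => a b; rewrite mul_diag_mx !mxE /term.
      by case: (phi a) => //; rewrite mul1r.
    rewrite det_mulmx (determinant_alternate (A := U) mm') ?mulr0 // => l.
    by rewrite !mxE pm pm'.
  apply: le_trans (ler_wpM2l (normr_ge0 _) (ler_weXn2l rho1 (sum_capped_weight phi_inj))) _.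
  rewrite -prodrXr.
  apply: le_trans (ler_wpM2r _ (ler_norm_sum _ _ _)) _.
    by apply: prodr_ge0 => m _; exact: exprn_ge0.
  rewrite mulr_suml; apply: ler_sum => s _.
  rewrite normrM normrX normrN1 expr1n mul1r normr_prod -big_split /=.
  by apply: ler_prod => m _; rewrite mxE w0 /=.
rewrite exchange_big /=.
apply: (@le_trans _ _ (\sum_(s : 'S_N) B ^+ N)); last first.
  have cS : #|{: 'S_N}| = N`! by rewrite -card_Sn; apply: eq_card => s; rewrite !inE.
  by rewrite sumr_const cS mulr_natl.
(* The sum over all choices [phi], injective or not, is again a product of row sums, each at most
   [B]. *)
apply: ler_sum => s _; rewrite -(bigA_distr_bigA (fun m o => w m (s m) o)) /=.
rewrite -[X in _ <= _ ^+ X](card_ord N) -prodr_const; apply: ler_prod => m _.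
rewrite sumr_ge0 //= big_option addrC /w /=; apply: le_trans (hB m (s m)).
by rewrite lexx.
Qed.

(** * Taylor expansions of z^i e^(jz) *)

Lemma ffact_Vandermonde i p t :
  ((i + p) ^_ t = \sum_(k < t.+1) 'C(t, k) * i ^_ k * p ^_ (t - k))%N.
Proof.
rewrite -bin_ffact -binomial.Vandermonde big_distrl /=; apply: eq_bigr => k _.
have kt : (k <= t)%N by rewrite -ltnS.
by rewrite -!bin_ffact -(bin_fact kt); ring.
Qed.

Lemma leq_wexp2r m n e : (m <= n)%N -> (m ^ e <= n ^ e)%N.
Proof. by case: e => // e; rewrite leq_exp2r. Qed.

Lemma ffact_leq_exp n m : (n ^_ m <= n ^ m)%N.
Proof.
rewrite ffact_prod -[X in (_ <= _ ^ X)%N](card_ord m) -prod_nat_const.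
by apply: leq_prod => k _; exact: leq_subr.
Qed.

Lemma taylor_coef_le (s t i j S q J T : nat) :
    (s <= S)%N -> (i <= S * q)%N -> (j <= J)%N -> (t <= T)%N ->
    (0 < S)%N -> (0 < J + q)%N ->
  (taylor_coef s t i j <= S ^ (S * q) * (J + q) ^ T)%N.
Proof.
move=> sS iM jJ tT S0 V0.
apply: (@leq_trans (S ^ i * (J + q) ^ t)); last by rewrite leq_mul ?leq_pexp2l.
rewrite /taylor_coef expnDn big_distrr /=; apply: leq_sum => k _.
have [ki|ik] := leqP k i; last by rewrite ffact_small // muln0 !mul0n.
have -> : (S ^ i * ('C(t, k) * (J ^ (t - k) * q ^ k))
    = 'C(t, k) * (S * q) ^ k * S ^ (i - k) * J ^ (t - k))%N.
  by rewrite -[in LHS](subnKC ki) expnD expnMn; ring.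
rewrite !leq_mul ?leq_wexp2r //.
exact: leq_trans (ffact_leq_exp _ _) (leq_wexp2r _ iM).
Qed.

(* deriv_pow s t n * exp_taylor i j n is the n-th term of the Taylor expansion
   at 0 of z^i e^(jz), differentiated t times and evaluated at s. *)
Definition exp_taylor (F : fieldType) (i j n : nat) : F :=
  if (i <= n)%N then j%:R ^+ (n - i) / (n - i)`!%:R else 0.
Definition deriv_pow (F : fieldType) (s t n : nat) : F := (n ^_ t * s ^ (n - t))%:R.

(** If k of the t derivatives fall on z^i, the others turn the exponential term of order n - i into
    j^(t-k) times the one of order n - i - (t-k) at j s. For each k the sum over n is then a
    truncated exponential series. *)
Lemma taylor_termE (F : numFieldType) s t i j n :
  deriv_pow F s t n * exp_taylor F i j n
  = \sum_(k < t.+1) ('C(t, k) * i ^_ k * s ^ (i - k) * j ^ (t - k))%:R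
      * (if (i + (t - k) <= n)%N
         then (j * s)%:R ^+ (n - (i + (t - k))) / (n - (i + (t - k)))`!%:R else 0).
Proof.
rewrite /exp_taylor; case: leqP => [le_in|lt_ni]; last first.
  by rewrite mulr0 big1 // => k _; rewrite ifN ?mulr0 // -ltnNge; lia.
have {le_in} [p ->] : exists p, n = (i + p)%N by exists (n - i)%N; lia.
rewrite addKn /deriv_pow ffact_Vandermonde big_distrl /= natr_sum mulr_suml.
apply: eq_bigr => k _; have kt := ltn_ord k.
have [ki|ik] := leqP k i; last by rewrite ffact_small // muln0 !mul0n !mul0r.
case: leqP => [h|h]; last first.
  by rewrite [(p ^_ _)%N]ffact_small ?muln0 ?mul0n ?mulr0 ?mul0r //; lia.
have {h} [r pE] : exists r, p = ((t - k) + r)%N by exists (p - (t - k))%N; lia.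
have -> : (i + p - (i + (t - k)) = r)%N by lia.
have -> : (i + p - t = (i - k) + r)%N by lia.
have <- : (p ^_ (t - k) * r`! = p`!)%N.
  by rewrite -(@ffact_fact p (t - k)) ?pE ?leq_addr // addKn.
rewrite {2}pE !expnD !exprD !natrM !natrX.
have f0 (m : nat) : m`!%:R != 0 :> F by rewrite pnatr_eq0 -lt0n fact_gt0.
have : (p ^_ (t - k))%:R != 0 :> F by rewrite pnatr_eq0 -lt0n ffact_gt0 pE leq_addr.
by move: (f0 r) => f1 f2; rewrite exprMn; field; rewrite f1 f2.
Qed.

Definition exp_trunc (F : fieldType) (m : nat) (y : F) : F := \sum_(q < m) y ^+ q / q`!%:R.

Lemma sum_ord_shift (V : nmodType) (N h : nat) (g : nat -> V) :
  \sum_(n < N) (if (h <= n)%N then g (n - h)%N else 0) = \sum_(q < N - h) g q.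
Proof.
have [hN|Nh] := leqP h N; last first.
  have -> : (N - h = 0)%N by lia.
  by rewrite big_ord0 big1 // => n _; rewrite ifN // -ltnNge (ltn_trans _ Nh).
rewrite -(big_mkord xpredT (fun n => if (h <= n)%N then g (n - h)%N else 0)).
rewrite -(big_mkord xpredT g) (big_cat_nat (n := h)) //= big_nat big1 ?add0r; last first.
  by move=> n /andP[_ nh]; rewrite leqNgt nh.
rewrite -{1}[h]add0n big_addn; apply: eq_bigr => n _.
by rewrite leq_addl addnK.
Qed.

Lemma taylor_sumE (F : numFieldType) s t i j N (rho : F) :
  \sum_(n < N) deriv_pow F s t n * exp_taylor F i j n * rho ^+ n
  = \sum_(k < t.+1) ('C(t, k) * i ^_ k * s ^ (i - k) * j ^ (t - k))%:R
      * (rho ^+ (i + (t - k)) * exp_trunc (N - (i + (t - k))) (rho * (j * s)%:R)).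
Proof.
under eq_bigr do rewrite taylor_termE mulr_suml; rewrite exchange_big /=.
apply: eq_bigr => k _; set h := (i + (t - k))%N.
under eq_bigr do rewrite -mulrA; rewrite -mulr_sumr; congr (_ * _).
rewrite /exp_trunc mulr_sumr.
rewrite -(sum_ord_shift N h (fun q => rho ^+ h * ((rho * (j * s)%:R) ^+ q / q`!%:R))).
apply: eq_bigr => n _.
case: leqP => [hn|_]; last by rewrite mul0r.
have -> : rho ^+ n = rho ^+ h * rho ^+ (n - h) by rewrite -exprD subnKC.
by rewrite exprMn; ring.
Qed.

Lemma exp_truncE (R : realType) m (y : R) : exp_trunc m y = series (exp_coeff y) m.
Proof. by rewrite /exp_trunc /series /= big_mkord; apply: eq_bigr. Qed.

Lemma exp_trunc_le (R : realType) m (y : R) : 0 <= y -> exp_trunc m y <= expR y.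
Proof.
move=> y0; rewrite exp_truncE; apply: nondecreasing_cvgn_le.
  apply: nondecreasing_series => n _ _; exact: exp_coeff_ge0.
exact: is_cvg_series_exp_coeff.
Qed.

Lemma expR_le_trunc (R : realType) (y U : R) :
  (forall n, exp_trunc n y <= U) -> expR y <= U.
Proof.
move=> h; apply: limr_le; first exact: is_cvg_series_exp_coeff.
by apply: nearW => n; rewrite -exp_truncE.
Qed.

Lemma exp_trunc_homo (R : realType) m n (y : R) : 0 <= y -> (m <= n)%N ->
  exp_trunc m y <= exp_trunc n y.
Proof.
move=> y0 mn; rewrite !exp_truncE; apply: nondecreasing_series => // k _ _.
exact: exp_coeff_ge0.
Qed.

(** For q >= m, rho^m y^q <= (rho y)^q: the weighted tail fits into the part of the series of
    exp(rho y) from index [m] on. *)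
Lemma exp_trunc_tail (R : realType) m (rho y : R) : 0 <= y -> 1 <= rho ->
  exp_trunc m (rho * y) + rho ^+ m * (expR y - exp_trunc m y) <= expR (rho * y).
Proof.
move=> y0 rho1; have rho0 : 0 < rho by exact: lt_le_trans rho1.
rewrite addrC -lerBrDr mulrC -ler_pdivlMr ?exprn_gt0 // lerBlDr.
apply: expR_le_trunc => n.
rewrite -lerBlDr ler_pdivlMr ?exprn_gt0 //.
have ry0 : 0 <= rho * y by rewrite mulr_ge0 // ltW.
apply: le_trans (lerB (exp_trunc_le (maxn m n) ry0) (lexx _)).
have nk : exp_trunc n y <= exp_trunc (maxn m n) y by rewrite exp_trunc_homo // leq_maxr.
apply: le_trans (ler_wpM2r (exprn_ge0 m (ltW rho0)) (lerB nk (lexx _))) _.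
have {n nk} [n ->] : exists k, maxn m n = (m + k)%N by exists (maxn m n - m)%N; lia.
rewrite /exp_trunc !big_split_ord /= [X in X * _ <= _]addrAC subrr add0r.
rewrite [leRHS]addrAC subrr add0r mulr_suml.
apply: ler_sum => k _; rewrite exprMn [rho ^+ _ * _]mulrC -!mulrA ler_wpM2l ?exprn_ge0 //.
rewrite mulrC ler_wpM2r ?invr_ge0 ?ler0n // ler_weXn2l ?leq_addr //.
Qed.

(** For each Leibniz index k put h = i + (t - k), at most M + T. In rho^n = rho^h rho^(n-h) the
    second factor is absorbed by the exponential series at rho j s, and so is the tail, by
    [exp_trunc_tail]. *)
Lemma taylor_sum_tail (R : realType) (s t i j N M T : nat) (rho : R) :
    1 <= rho -> (i <= M)%N -> (t <= T)%N ->
  let tail := (taylor_coef s t i j)%:R * expR (j * s)%:R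
       - \sum_(n < N) deriv_pow R s t n * exp_taylor R i j n in
  0 <= tail /\
  \sum_(n < N) deriv_pow R s t n * exp_taylor R i j n * rho ^+ n + rho ^+ N * tail
  <= rho ^+ (M + T) * (taylor_coef s t i j)%:R * expR (rho * (j * s)%:R).
Proof.
move=> rho1 iM tT tail; have rho0 : 0 < rho by exact: lt_le_trans rho1.
set y : R := (j * s)%:R in tail *; have y0 : 0 <= y by exact: ler0n.
pose c k := ('C(t, k) * i ^_ k * s ^ (i - k) * j ^ (t - k))%N.
have tailE : tail = \sum_(k < t.+1) (c k)%:R * (expR y - exp_trunc (N - (i + (t - k))) y).
  have := taylor_sumE s t i j N (1 : R); under eq_bigr do rewrite expr1n mulr1.
  rewrite /tail => ->; rewrite natr_sum mulr_suml -sumrB; apply: eq_bigr => k _.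
  by rewrite expr1n !mul1r mulrBr.
split.
  rewrite tailE; apply: sumr_ge0 => k _; rewrite mulr_ge0 // subr_ge0.
  exact: exp_trunc_le.
rewrite taylor_sumE -/y tailE /taylor_coef natr_sum !mulr_sumr mulr_suml -big_split /=.
apply: ler_sum => k _; rewrite [X in _ + X <= _]mulrCA -mulrDr mulrAC [leRHS]mulrC.
rewrite ler_wpM2l // -/y.
apply: (@le_trans _ _ (rho ^+ (i + (t - k)) * expR (rho * y))); last first.
  by rewrite ler_wpM2r ?expR_ge0 // ler_weXn2l //; lia.
set h := (i + (t - k))%N.
(* For h > N the truncation is empty and the tail is the whole exponential. *)
have [hN|Nh] := leqP h N; last first.
  have -> : (N - h = 0)%N by lia.
  rewrite /exp_trunc !big_ord0 mulr0 add0r subr0.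
  apply: ler_pM; rewrite ?exprn_ge0 ?expR_ge0 ?(ltW rho0) //.
    by rewrite ler_weXn2l // ltnW.
  by rewrite ler_expR ler_peMl.
rewrite -{2}(subnKC hN) exprD -mulrA -mulrDr ler_wpM2l ?exprn_ge0 ?(ltW rho0) //.
exact: exp_trunc_tail.
Qed.

(** * Liouville's inequality *)

(** Expanding the product of row sums gives a term for every map of the indices; the determinant
    uses only the injective ones. *)
Lemma norm_det_le (F : numDomainType) n (A : 'M[F]_n) :
  `|\det A| <= \prod_i \sum_j `|A i j|.
Proof.
rewrite bigA_distr_bigA /=; apply: le_trans (ler_norm_sum _ _ _) _.
rewrite [leRHS](bigID (fun f : {ffun 'I_n -> 'I_n} => injectiveb f)) /=.
rewrite -[leLHS]addr0; apply: lerD; last first.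
  by apply: sumr_ge0 => f _; apply: prodr_ge0 => i _; exact: normr_ge0.
have pinj (s : 'S_n) : injectiveb (pval s).
  by apply/injectiveP => x y; rewrite pvalE => /perm_inj.
rewrite (reindex_onto (fun s : 'S_n => pval s) (fun f => insubd (1%g : 'S_n) f)) /=.
  rewrite [leRHS](eq_bigl xpredT) => [|s]; last first.
    by rewrite pinj; apply/eqP/val_inj; rewrite val_insubd pinj.
  apply: ler_sum => s _; rewrite normrM normrX normrN1 expr1n mul1r normr_prod.
  by apply: ler_prod => i _; rewrite normr_ge0 /= pvalE.
by move=> f f_inj; rewrite [LHS]val_insubd f_inj.
Qed.

(** The cofactor is the determinant after row [i] is replaced by a unit vector, whose row sum is
    1. *)
Lemma norm_cofactor_le (F : numDomainType) n (A : 'M[F]_n) i j (B : 'I_n -> F) :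
    (forall k, \sum_l `|A k l| <= B k) ->
  `|cofactor A i j| <= \prod_(k | k != i) B k.
Proof.
move=> AB; pose A' := \matrix_(k, l) (if k == i then (l == j)%:R else A k l).
have -> : cofactor A i j = \det A'.
  rewrite (expand_det_row _ i) (bigD1 j) //= big1 ?addr0 => [|l lj]; last first.
    by rewrite mxE eqxx (negbTE lj) mul0r.
  rewrite mxE !eqxx mul1r /cofactor; congr (_ * \det _).
  by apply/matrixP => k l; rewrite !mxE eq_sym (negbTE (neq_lift _ _)).
apply: le_trans (norm_det_le _) _.
rewrite (bigD1 i) //= (_ : \sum__ _ = 1) ?mul1r.
  apply: ler_prod => k ki; rewrite sumr_ge0 //=.
  by under eq_bigr do rewrite mxE (negbTE ki).
rewrite (bigD1 j) //= big1 ?addr0 ?mxE ?eqxx ?normr1 // => l lj.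
by rewrite mxE eqxx (negbTE lj) normr0.
Qed.

Lemma poly_lengthE (F : numDomainType) (P : {poly int}) n : (size P <= n)%N ->
  (poly_length P)%:~R = \sum_(i < n) `|(P`_i)%:~R| :> F.
Proof.
move=> Pn; rewrite /poly_length rmorph_sum /=.
under eq_bigr do rewrite intr_norm.
rewrite (big_ord_widen n (fun i => `|(P`_i)%:~R : F|) Pn).
rewrite [RHS](bigID (fun i : 'I_n => (i < size P)%N)) /=.
rewrite [X in _ = _ + X]big1 ?addr0 // => i; rewrite -leqNgt => iP.
by rewrite nth_default // normr0.
Qed.

Lemma poly_length_ge1 (P : {poly int}) : P != 0 -> 1 <= poly_length P.
Proof.
move=> P0; have sP : (0 < size P)%N by rewrite size_poly_gt0.
have lP : ((size P).-1 < size P)%N by rewrite prednK.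
rewrite /poly_length (bigD1 (Ordinal lP)) //=.
rewrite -lead_coefE; have := lead_coef_eq0 P; rewrite (negbTE P0) => /eqP l0.
by apply: (@le_trans _ _ `|lead_coef P|); [lia|rewrite lerDl sumr_ge0].
Qed.

(** A nonconstant common divisor would be associate to [P], so [P] would divide [Q] and [Q] would
    vanish at [x]. Passing to [zprimitive P] makes the division possible over the integers. *)
Lemma irreducible_resultant_neq0 (F : numFieldType) (P Q : {poly int}) (x : F) :
    irreducible_poly P -> (map_poly intr P).[x] = 0 -> (map_poly intr Q).[x] != 0 ->
  resultant P Q != 0.
Proof.
move=> [P1 irrP] Px Qx; rewrite resultant_eq0 -leqNgt.
have P0 : P != 0 by apply: contraTneq P1 => ->; rewrite size_poly0.
have zPx : (map_poly (intr : int -> F) (zprimitive P)).[x] = 0.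
  move/eqP: Px; rewrite {1}[P]zpolyEprim map_polyZ hornerZ mulf_eq0.
  by rewrite intr_eq0 zcontents_eq0 (negbTE P0) => /eqP.
rewrite leq_eqVlt; apply/orP; left; apply: contraNT Qx => /irrP.
move=> /(_ (dvdp_gcdl _ _)) /eqp_dvdl e.
have [r ->] : {r | Q = zprimitive P * r} by apply: dvdpP_int; rewrite -e dvdp_gcdr.
by rewrite rmorphM hornerM zPx mul0r.
Qed.

(** Reads a row of a Sylvester matrix. A general [g] serves both for the product with the powers of
    x and for sums of absolute values. *)
Lemma sum_shifted_coef (V : nmodType) (F : nzRingType) (N k : nat)
    (p : {poly F}) (g : F -> nat -> V) :
    (k <= N)%N -> (forall n, g 0 n = 0) ->
  \sum_(j < N) g (p`_(j - k) *+ (k <= j)%N) j = \sum_(i < N - k) g p`_i (i + k)%N.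
Proof.
move=> kN g0; rewrite -(sum_ord_shift N k (fun i => g p`_i (i + k)%N)).
by apply: eq_bigr => j _; case: leqP => kj; rewrite ?mulr0n ?g0 // subnK.
Qed.

(* Applying the Sylvester matrix to the vector of the
   powers of x annihilates its P-rows; Cramer's rule for the highest power
   then bounds the integer resultant by the value Q(x). *)
Lemma liouville (F : numFieldType) (P Q : {poly int}) (x : F) :
    irreducible_poly P -> (map_poly intr P).[x] = 0 -> (map_poly intr Q).[x] != 0 ->
    1 <= `|x| ->
  1 <= (size P).-1%:R * `|(map_poly intr Q).[x]|
       * (poly_length P)%:~R ^+ (size Q).-1 * (poly_length Q)%:~R ^+ (size P).-2.
Proof.
move=> irrP Px Qx x1; have [P1 _] := irrP.
have := irreducible_resultant_neq0 irrP Px Qx; rewrite /resultant.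
set q := map_poly _ Q in Qx *.
set m := (size Q).-1; set d := (size P).-1; set A := Sylvester_mx P Q => detA.
have d0 : (0 < d)%N by rewrite /d -subn1 subn_gt0.
have mQ : (size Q <= m.+1)%N by exact: leqSpred.
have dP : (size P <= d.+1)%N by exact: leqSpred.
pose A' : 'M[F]_(m + d) := map_mx intr A.
have rowP (k : 'I_m) (V : nmodType) (g : F -> nat -> V) : (forall n, g 0 n = 0) ->
    \sum_j g (A' (lshift d k) j) j = \sum_(i < m + d - k) g (P`_i)%:~R (i + k)%N.
  move=> g0; rewrite -(@sum_shifted_coef V int _ _ P (fun a n => g a%:~R n)) //.
  - apply: eq_bigr => j _; rewrite mxE Sylvester_mxE.
    by rewrite (unsplitK (inl k : 'I_m + 'I_d)).
  - by have := ltn_ord k; lia.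
have rowQ (k : 'I_d) (V : nmodType) (g : F -> nat -> V) : (forall n, g 0 n = 0) ->
    \sum_j g (A' (rshift m k) j) j = \sum_(i < m + d - k) g (Q`_i)%:~R (i + k)%N.
  move=> g0; rewrite -(@sum_shifted_coef V int _ _ Q (fun a n => g a%:~R n)) //.
  - apply: eq_bigr => j _; rewrite mxE Sylvester_mxE.
    by rewrite (unsplitK (inr k : 'I_m + 'I_d)).
  - by have := ltn_ord k; lia.
pose v : 'cV[F]_(m + d) := \col_j x ^+ j.
have evalE (p : {poly int}) n k : (size p <= n)%N ->
    \sum_(i < n) (p`_i)%:~R * x ^+ (i + k) = x ^+ k * (map_poly intr p).[x].
  move=> pn; rewrite (@horner_coef_wide _ n) ?(leq_trans (size_poly _ _)) //.
  by rewrite mulr_sumr; apply: eq_bigr => i _; rewrite coef_map exprD /=; ring.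
have vP (k : 'I_m) : (A' *m v) (lshift d k) 0 = 0.
  rewrite mxE; under eq_bigr do rewrite [v _ _]mxE.
  rewrite (rowP k _ (fun a n => a * x ^+ n)) => [|n]; last by rewrite mul0r.
  by rewrite evalE ?Px ?mulr0 //; have := ltn_ord k; lia.
have vQ (k : 'I_d) : (A' *m v) (rshift m k) 0 = x ^+ k * q.[x].
  rewrite mxE; under eq_bigr do rewrite [v _ _]mxE.
  rewrite (rowQ k _ (fun a n => a * x ^+ n)) => [|n]; last by rewrite mul0r.
  by rewrite evalE //; have := ltn_ord k; lia.
set lP := (poly_length P)%:~R; set lQ := (poly_length Q)%:~R.
pose B (k : 'I_(m + d)) : F := if fintype.split k is inl _ then lP else lQ.
have AB k : \sum_l `|A' k l| <= B k.
  rewrite /B; case: fintype.splitP => k' kk'.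
    have -> : k = lshift d k' by apply: val_inj.
    rewrite (rowP k' _ (fun a _ => `|a|)) ?normr0 //.
    by rewrite -poly_lengthE //; have := ltn_ord k'; lia.
  have -> : k = rshift m k' by apply: val_inj.
  rewrite (rowQ k' _ (fun a _ => `|a|)) ?normr0 //.
  by rewrite -poly_lengthE //; have := ltn_ord k'; lia.
have md : ((m + d).-1 < m + d)%N by lia.
pose top := Ordinal md.
have cramer : (\det A)%:~R * x ^+ (m + d).-1
    = \sum_(k < d) cofactor A' (rshift m k) top * (x ^+ k * q.[x]).
  have : (\adj A' *m (A' *m v)) top 0 = (\det A)%:~R * x ^+ (m + d).-1.
    by rewrite mulmxA mul_adj_mx mul_scalar_mx det_map_mx !mxE.
  move=> <-; rewrite mxE big_split_ord /= big1 ?add0r => [|k _]; last by rewrite vP mulr0.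
  by apply: eq_bigr => k _; rewrite vQ mxE.
have lP0 : 0 <= lP by rewrite /lP (poly_lengthE _ dP) sumr_ge0.
have lQ0 : 0 <= lQ by rewrite /lQ (poly_lengthE _ mQ) sumr_ge0.
have cof (k : 'I_d) : `|cofactor A' (rshift m k) top| <= lP ^+ m * lQ ^+ d.-1.
  apply: le_trans (norm_cofactor_le _ _ AB) _.
  rewrite big_mkcond big_split_ord /=.
  apply: ler_pM; rewrite ?prodr_ge0 //.
  - by move=> i _; case: ifP => // _; rewrite /B; case: fintype.split.
  - by move=> i _; case: ifP => // _; rewrite /B; case: fintype.split.
  - rewrite (eq_bigr (fun=> lP)) ?prodr_const ?card_ord // => i _.
    by rewrite eq_lrshift /B (unsplitK (inl i : 'I_m + 'I_d)).
  rewrite -big_mkcond /= (eq_bigl (predC1 k)); last first.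
    by move=> i /=; rewrite eq_rshift.
  rewrite (eq_bigr (fun=> lQ)) ?prodr_const ?cardC1 ?card_ord // => i _.
  by rewrite /B (unsplitK (inr i : 'I_m + 'I_d)).
(* As 1 <= |x|, this power of |x| dominates all the |x|^k with k < d on the other side, and
   cancels. *)
have top0 : 0 < `|x| ^+ (m + d).-1 by rewrite exprn_gt0 // (lt_le_trans ltr01).
rewrite -(ler_pM2r top0) mul1r.
apply: (@le_trans _ _ (`|(\det A)%:~R * x ^+ (m + d).-1|)).
  rewrite normrM normrX ler_peMl ?(ltW top0) // -intr_norm.
  by rewrite -[1]/(1%:~R) ler_int -gtz0_ge1 normr_gt0.
rewrite cramer; apply: le_trans (ler_norm_sum _ _ _) _.
apply: (@le_trans _ _ (\sum_(k < d) lP ^+ m * lQ ^+ d.-1 * (`|x| ^+ (m + d).-1 * `|q.[x]|))).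
  apply: ler_sum => k _; rewrite normrM; apply: ler_pM; rewrite ?cof //.
  rewrite normrM normrX ler_wpM2r // ler_weXn2l //.
  by have := ltn_ord k; lia.
rewrite sumr_const card_ord -mulr_natl le_eqVlt; apply/orP; left; apply/eqP.
by ring.
Qed.

(** * Landau's inequality and lengths of factors *)

Definition poly_norm1 (C : numDomainType) (p : {poly C}) : C := \sum_(i < size p) `|p`_i|.
Definition poly_sqnorm2 (C : numDomainType) (p : {poly C}) : C :=
  \sum_(i < size p) `|p`_i| ^+ 2.

Lemma poly_sum_wide (V : nmodType) (C : numDomainType) (g : C -> V) (p : {poly C}) n :
  g 0 = 0 -> (size p <= n)%N -> \sum_(i < size p) g p`_i = \sum_(i < n) g p`_i.
Proof.
move=> g0 pn; rewrite (big_ord_widen n (fun i => g p`_i) pn).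
rewrite [RHS](bigID (fun i : 'I_n => (i < size p)%N)) /=.
rewrite [X in _ = _ + X]big1 ?addr0 // => i; rewrite -leqNgt => iP.
by rewrite nth_default // g0.
Qed.

(** The i-th terms differ by (1 - |r|^2)(|q_(i-1)|^2 - |q_i|^2), which telescopes to 0. *)
Lemma sqnorm2_flip (C : numClosedFieldType) (q : {poly C}) (r : C) :
  poly_sqnorm2 (('X - r%:P) * q) = poly_sqnorm2 ((r^* *: 'X - 1) * q).
Proof.
pose n := (size q).+1.
have s1 : (size (('X - r%:P) * q)%R <= n)%N.
  by apply: leq_trans (size_polyMleq _ _) _; rewrite size_XsubC.
have s2 : (size ((r^* *: 'X - 1) * q)%R <= n)%N.
  apply: leq_trans (size_polyMleq _ _) _.
  have : (size (r^* *: 'X - 1 : {poly C})%R <= 2)%N.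
    apply: leq_trans (size_polyD _ _) _; rewrite size_polyN size_poly1 geq_max andbT.
    by apply: leq_trans (size_scale_leq _ _) _; rewrite size_polyX.
  by rewrite /n; lia.
have g0 : `|0 : C| ^+ 2 = 0 by rewrite normr0 expr0n.
rewrite /poly_sqnorm2 (poly_sum_wide (g := fun x => `|x| ^+ 2) g0 s1).
rewrite (poly_sum_wide (g := fun x => `|x| ^+ 2) g0 s2).
apply/eqP; rewrite -subr_eq0 -sumrB; apply/eqP.
pose h i := if i is i'.+1 then `|q`_i'| ^+ 2 else 0.
rewrite (eq_bigr (fun i : 'I_n => (1 - `|r| ^+ 2) * (h i - h i.+1))).
  rewrite -mulr_sumr; have -> : \sum_(i < n) (h i - h i.+1) = h 0%N - h n.
    rewrite -(big_mkord xpredT (fun i => h i - h i.+1)) -opprB -telescope_sumr //.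
    by rewrite -sumrN; apply: eq_bigr => i _; rewrite opprB.
  by rewrite /h /n nth_default // normr0 expr0n subrr mulr0.
move=> i _; rewrite !mulrBl mul1r -scalerAl !coefB coefZ coefXM coefCM.
rewrite !normCK; case: (nat_of_ord i) => [|k] /=.
  by rewrite !rmorphB !rmorphM !rmorph0 /= ?normCK ?conjCK; ring.
by rewrite /h !normCK !rmorphB !rmorphM /= conjCK; ring.
Qed.

(* max(1, |r|), written with a test since the order of C is only partial. *)
Definition outer_weight (C : numDomainType) (r : C) : C := if `|r| <= 1 then 1 else `|r|.

Lemma outer_weight_ge (C : numDomainType) (r : C) :
  (1 <= outer_weight r) && (`|r| <= outer_weight r).
Proof.
rewrite /outer_weight; case: ifPn => [->|]; first by rewrite lexx.
by rewrite -real_ltNge ?normr_real ?real1 // => /ltW ->; rewrite lexx.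
Qed.

Definition flip_factor (C : numClosedFieldType) (r : C) : {poly C} :=
  if `|r| <= 1 then 'X - r%:P else r^* *: 'X - 1.

Lemma sqnorm2_flip_prod (C : numClosedFieldType) (rs : seq C) (q : {poly C}) :
  poly_sqnorm2 (\prod_(r <- rs) ('X - r%:P) * q)
  = poly_sqnorm2 (\prod_(r <- rs) flip_factor r * q).
Proof.
elim: rs q => [|r rs IH] q; first by rewrite !big_nil.
rewrite !big_cons -!mulrA.
rewrite mulrCA IH mulrCA {2}/flip_factor; case: ifP => _ //.
exact: sqnorm2_flip.
Qed.

Lemma lead_coef_flip_factor (C : numClosedFieldType) (r : C) :
  `|lead_coef (flip_factor r)| = outer_weight r.
Proof.
rewrite /flip_factor /outer_weight; case: ifPn => r1; first by rewrite lead_coefXsubC normr1.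
have r0 : r^* != 0 by rewrite conjC_eq0; apply: contraNneq r1 => ->; rewrite normr0 ler01.
rewrite lead_coefDl ?lead_coefZ ?lead_coefX ?mulr1 ?norm_conjC //.
by rewrite size_polyN size_poly1 size_scale // size_polyX.
Qed.

(* Replacing X - r by its reciprocal conj(r) X - 1 for the roots outside the
   unit disk preserves the sum of the squares of the coefficients, and makes
   the Mahler measure the leading coefficient. *)
Lemma mahler_le_norm1 (C : numClosedFieldType) (a : C) (rs : seq C) :
  `|a| * \prod_(r <- rs) outer_weight r <= poly_norm1 (a *: \prod_(r <- rs) ('X - r%:P)).
Proof.
set p := a *: _; have n0 : 0 <= poly_norm1 p by rewrite sumr_ge0.
have w0 r : 0 <= outer_weight r.
  by have /andP[h _] := outer_weight_ge r; apply: le_trans h.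
have W0 : 0 <= \prod_(r <- rs) outer_weight r by rewrite prodr_ge0.
rewrite -ler_sqr ?nnegrE ?mulr_ge0 //.
pose F := \prod_(r <- rs) flip_factor r * a%:P.
have leadF : `|lead_coef F| = `|a| * \prod_(r <- rs) outer_weight r.
  rewrite /F lead_coefM lead_coefC lead_coef_prod normrM normr_prod mulrC.
  by congr (_ * _); apply: eq_bigr => r _; rewrite lead_coef_flip_factor.
apply: (@le_trans _ _ (poly_sqnorm2 p)); last first.
  rewrite /poly_sqnorm2 expr2 {2}/poly_norm1 mulr_sumr; apply: ler_sum => i _.
  by rewrite expr2 ler_wpM2r // /poly_norm1 (bigD1 i) //= lerDl sumr_ge0.
have -> : poly_sqnorm2 p = poly_sqnorm2 F.
  by rewrite /p -mul_polyC mulrC sqnorm2_flip_prod.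
rewrite -leadF; have [->|F0] := eqVneq F 0.
  by rewrite lead_coef0 normr0 expr0n /= sumr_ge0 // => i _; rewrite exprn_ge0.
have lF : ((size F).-1 < size F)%N by rewrite prednK // size_poly_gt0.
rewrite /poly_sqnorm2 (bigD1 (Ordinal lF)) //= -lead_coefE lerDl.
by apply: sumr_ge0 => i _; rewrite exprn_ge0.
Qed.

Lemma norm1_mul_XsubC (C : numDomainType) (q : {poly C}) (r : C) :
  poly_norm1 (('X - r%:P) * q) <= (1 + `|r|) * poly_norm1 q.
Proof.
pose n := (size q).+1.
have s1 : (size (('X - r%:P) * q)%R <= n)%N.
  by apply: leq_trans (size_polyMleq _ _) _; rewrite size_XsubC.
rewrite /poly_norm1 (poly_sum_wide (g := fun x => `|x|) (normr0 _) s1).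
apply: (@le_trans _ _ (\sum_(i < n) `|('X * q)`_i| + \sum_(i < n) `|(r *: q)`_i|)).
  rewrite -big_split /=; apply: ler_sum => i _.
  by rewrite mulrBl coefB mul_polyC; apply: ler_normB.
rewrite mulrDl mul1r lerD //.
  by rewrite big_ord_recl coefXM normr0 add0r; apply: ler_sum => i _; rewrite coefXM.
rewrite big_ord_recr /= coefZ nth_default // mulr0 normr0 addr0 mulr_sumr.
by apply: ler_sum => i _; rewrite coefZ normrM.
Qed.

(** Each factor X - r multiplies the norm by at most 1 + |r|, hence by at most 2 max(1, |r|). *)
Lemma norm1_le_mahler (C : numDomainType) (a : C) (rs : seq C) :
  poly_norm1 (a *: \prod_(r <- rs) ('X - r%:P))
  <= 2 ^+ size rs * (`|a| * \prod_(r <- rs) outer_weight r).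
Proof.
rewrite -mul_polyC; elim: rs => [|r rs IH].
  rewrite !big_nil !mulr1 mul1r /poly_norm1 size_polyC.
  by case: eqP => [->|_]; rewrite ?big_ord0 ?big_ord1 ?coefC.
rewrite !big_cons mulrCA; apply: le_trans (norm1_mul_XsubC _ _) _.
have /andP[w1 rw] := outer_weight_ge r.
apply: (@le_trans _ _ (2 * outer_weight r *
    (2 ^+ size rs * (`|a| * \prod_(r <- rs) outer_weight r)))).
  apply: ler_pM; rewrite ?addr_ge0 ?sumr_ge0 //.
  by rewrite mulrDl mul1r lerD.
by rewrite /= exprS le_eqVlt; apply/orP; left; apply/eqP; ring.
Qed.

Lemma poly_length_norm1 (C : numDomainType) (P : {poly int}) :
  (poly_length P)%:~R = poly_norm1 (map_poly intr P : {poly C}).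
Proof.
rewrite /poly_norm1 size_map_inj_poly ?rmorph0 //; last exact: intr_inj.
by rewrite (poly_lengthE C (leqnn _)); apply: eq_bigr => i _; rewrite coef_map.
Qed.

(** The Mahler measure M is multiplicative and at least 1 on nonzero integer polynomials, so M(A) <=
    M(AB) <= L(AB), while L(A) <= 2^(deg A) M(A). *)
Lemma poly_length_factor (C : numClosedFieldType) (A B : {poly int}) : A * B != 0 ->
  (poly_length A)%:~R <= 2 ^+ (size A).-1 * (poly_length (A * B))%:~R :> C.
Proof.
rewrite mulf_eq0 negb_or => /andP[A0 B0].
have sizeI (P : {poly int}) : size (map_poly intr P : {poly C}) = size P.
  by rewrite size_map_inj_poly ?rmorph0 //; exact: intr_inj.
rewrite !(poly_length_norm1 C) rmorphM /=.
have [rs As] := closed_field_poly_normal (map_poly intr A : {poly C}).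
have [ss Bs] := closed_field_poly_normal (map_poly intr B : {poly C}).
have srs : size rs = (size A).-1.
  rewrite -(sizeI A) As size_scale ?size_prod_XsubC //.
  by rewrite lead_coef_eq0 -size_poly_eq0 sizeI size_poly_eq0.
have b1 : 1 <= `|lead_coef (map_poly intr B : {poly C})|.
  rewrite lead_coef_map_inj ?rmorph0 //; last exact: intr_inj.
  by rewrite -intr_norm -[1]/(1%:~R) ler_int -gtz0_ge1 normr_gt0 lead_coef_eq0.
set a := lead_coef _ in As; set b := lead_coef _ in Bs b1.
have -> : map_poly intr A * map_poly intr B = (a * b) *: \prod_(r <- rs ++ ss) ('X - r%:P).
  by rewrite As Bs big_cat -scalerAl -scalerAr scalerA.
apply: le_trans (ler_wpM2l (exprn_ge0 _ (ler0n _ 2)) (mahler_le_norm1 (a * b) (rs ++ ss))).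
rewrite As; apply: le_trans (norm1_le_mahler a rs) _; rewrite srs.
have w1 r : 1 <= outer_weight r :> C by have /andP[] := outer_weight_ge r.
have W0 (ts : seq C) : 0 <= \prod_(r <- ts) outer_weight r.
  by rewrite prodr_ge0 // => r _; apply: le_trans (w1 r).
rewrite ler_wpM2l ?exprn_ge0 // big_cat /= normrM.
rewrite [leRHS](_ : _ = `|a| * \prod_(r <- rs) outer_weight r
  * (`|b| * \prod_(r <- ss) outer_weight r)); last by ring.
rewrite ler_peMr ?mulr_ge0 // mulr_ege1 //.
elim: (ss) => [|r l IH]; first by rewrite big_nil.
by rewrite big_cons mulr_ege1.
Qed.

(** * Approximation of e by algebraic numbers *)

Local Open Scope complex_scope.

Lemma normc_real (R : realType) (x : R) : 0 <= x -> `|x%:C| = x%:C.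
Proof. by move=> x0; rewrite ger0_norm // lecR. Qed.

Lemma natc (R : realType) n : n%:R = (n%:R : R)%:C.
Proof. by rewrite rmorph_nat. Qed.

Lemma expR1_le4 (R : realType) : expR 1 <= 4 :> R.
Proof.
have h : expR (2^-1) <= 2 :> R.
  rewrite -[leLHS]invrK -expRN -[leRHS]invrK lef_pV2 ?posrE ?expR_gt0 ?invr_gt0 //.
  by apply: le_trans (expR_ge1Dx _); lra.
have -> : expR 1 = expR (2^-1) * expR (2^-1) :> R by rewrite -expRD; congr expR; lra.
by have := expR_gt0 (2^-1 : R); nra.
Qed.

Lemma expR1_ge2 (R : realType) : 2 <= expR 1 :> R.
Proof. by have := expR_ge1Dx (1 : R); lra. Qed.

Lemma exp_taylor_rmorph (F G : fieldType) (f : {rmorphism F -> G}) i j n :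
  f (exp_taylor F i j n) = exp_taylor G i j n.
Proof.
rewrite /exp_taylor; case: ifP => _; last exact: rmorph0.
by rewrite fmorph_div rmorphXn /= !rmorph_nat.
Qed.

Lemma deriv_pow_rmorph (F G : fieldType) (f : {rmorphism F -> G}) s t n :
  f (deriv_pow F s t n) = deriv_pow G s t n.
Proof. by rewrite /deriv_pow rmorph_nat. Qed.

Lemma norm_powB_le (F : numFieldType) (x y c : F) n :
  `|x| <= c -> `|y| <= c -> 1 <= c -> `|x ^+ n - y ^+ n| <= `|x - y| * (2 * c) ^+ n.
Proof.
move=> xc yc c1; have c0 : 0 <= c by apply: le_trans c1.
rewrite subrXX normrM ler_wpM2l //.
apply: le_trans (ler_norm_sum _ _ _) _.
apply: (@le_trans _ _ (\sum_(i < n) c ^+ n)).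
  apply: ler_sum => i _; rewrite normrM !normrX.
  apply: (@le_trans _ _ (c ^+ (n.-1 - i) * c ^+ i)).
    by rewrite ler_pM ?exprn_ge0 ?lerXn2r ?nnegrE.
  by rewrite -exprD ler_weXn2l //; have := ltn_ord i; lia.
rewrite sumr_const card_ord -[leLHS]mulr_natl [leRHS]exprMn ler_wpM2r ?exprn_ge0 //.
by rewrite -natrX ler_nat ltnW // ltn_expl.
Qed.

(** The entry minus its Taylor polynomial is the tail at e plus a multiple of xi^(js) - e^(js). This
    difference is at most rho^(-N) 10^(js), and 10 <= e^rho, so it obeys a bound of the same form as
    the tail; hence the factor 2. *)
Lemma interp_entry_bound (R : realType) (xi : R[i]) s t i j N M T (rho : R) :
    10 <= rho -> (i <= M)%N -> (t <= T)%N -> `|xi - (expR 1)%:C| <= (rho ^- N)%:C ->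
  \sum_(n < N) `|deriv_pow R[i] s t n * exp_taylor R[i] i j n| * rho%:C ^+ n
  + `|(taylor_coef s t i j)%:R * xi ^+ (j * s)
      - \sum_(n < N) deriv_pow R[i] s t n * exp_taylor R[i] i j n| * rho%:C ^+ N
  <= (2 * (rho ^+ (M + T) * (taylor_coef s t i j)%:R * expR (rho * (j * s)%:R)))%:C.
Proof.
move=> rho10 iM tT xie; have rho1 : 1 <= rho by lra.
have rho0 : 0 <= rho by lra.
have [tail0 tailB] := @taylor_sum_tail R s t i j N M T rho rho1 iM tT.
set a := taylor_coef s t i j in tail0 tailB *; set tail := _ - _ in tail0 tailB.
pose vu n : R := deriv_pow R s t n * exp_taylor R i j n.
have vuE n : deriv_pow R[i] s t n * exp_taylor R[i] i j n = (vu n)%:C.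
  by rewrite rmorphM /= deriv_pow_rmorph exp_taylor_rmorph.
have vu0 n : 0 <= vu n.
  by rewrite mulr_ge0 // /exp_taylor; case: ifP => // _; rewrite divr_ge0 ?exprn_ge0.
have -> : \sum_(n < N) `|deriv_pow R[i] s t n * exp_taylor R[i] i j n| * rho%:C ^+ n
   = (\sum_(n < N) vu n * rho ^+ n)%:C.
  rewrite rmorph_sum; apply: eq_bigr => n _.
  by rewrite vuE normc_real // [RHS]rmorphM [X in _ = _ * X]rmorphXn.
have -> : \sum_(n < N) deriv_pow R[i] s t n * exp_taylor R[i] i j n = (\sum_(n < N) vu n)%:C.
  by rewrite rmorph_sum; apply: eq_bigr => n _; rewrite vuE.
have -> : a%:R * xi ^+ (j * s) - (\sum_(n < N) vu n)%:C
   = tail%:C + a%:R * (xi ^+ (j * s) - (expR 1)%:C ^+ (j * s)).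
  rewrite /tail rmorphB rmorphM /= rmorph_nat -rmorphXn /= -expRM_natl mulr1.
  by ring.
clearbody tail; have rhoC0 : 0 <= rho%:C ^+ N by rewrite exprn_ge0 // lecR.
apply: (@le_trans _ _ ((\sum_(n < N) vu n * rho ^+ n + rho ^+ N * tail)%:C +
   a%:R * (`|xi ^+ (j * s) - (expR 1)%:C ^+ (j * s)| * rho%:C ^+ N))).
  rewrite [X in _ <= X + _]rmorphD /= -[leRHS]addrA lerD2l.
  apply: le_trans (ler_wpM2r rhoC0 (ler_normD _ _)) _.
  by rewrite normc_real // normrM normr_nat mulrDl rmorphM rmorphXn /= mulrC mulrA.
have cap : `|xi ^+ (j * s) - (expR 1)%:C ^+ (j * s)| * rho%:C ^+ N
    <= (expR (rho * (j * s)%:R))%:C.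
  have e4 := expR1_le4 R; have e0 := expR_gt0 (1 : R).
  (* The bound 5 allows 4 for e and 1 for the distance from xi to e, which is at most rho^(-N). *)
  have eC : `|(expR 1 : R)%:C| <= 5%:R.
    rewrite (normc_real (ltW e0)) natc lecR; lra.
  have xi5 : `|xi| <= 5%:R.
    rewrite -[xi](subrK (expR 1)%:C); apply: le_trans (ler_normD _ _) _.
    rewrite (normc_real (ltW e0)); apply: le_trans (lerD xie (lexx _)) _.
    rewrite -rmorphD /= natc lecR.
    have : rho ^- N <= 1 by rewrite invf_le1 ?exprn_ege1 // exprn_gt0 //; lra.
    lra.
  apply: le_trans (ler_wpM2r rhoC0 (norm_powB_le _ xi5 eC _)) _; first by rewrite ler1n.
  rewrite mulrAC; apply: (@le_trans _ _ (1 * (2 * 5%:R) ^+ (j * s))).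
    rewrite ler_wpM2r ?exprn_ge0 ?mulr_ge0 //.
    apply: le_trans (ler_wpM2r rhoC0 xie) _.
    rewrite -rmorphXn -rmorphM /= mulVf ?rmorph1 //.
    by rewrite expf_neq0 //; lra.
  rewrite mul1r -natrM -natrX natc lecR natrX.
  rewrite [X in expR X]mulrC expRM_natl lerXn2r ?nnegrE ?expR_ge0 //.
  by apply: le_trans (expR_ge1Dx _); lra.
have aC0 : 0 <= a%:R :> R[i] by exact: ler0n.
have tailBC := tailB; rewrite -lecR in tailBC.
apply: le_trans (lerD tailBC (ler_wpM2l aC0 cap)) _.
rewrite natc -rmorphM -rmorphD lecR /=.
rewrite mulr_natl mulr2n lerD2l ler_wpM2r ?expR_ge0 //.
by rewrite ler_peMl // exprn_ege1.
Qed.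

(** * Degree and length of the determinants *)

Lemma poly_length_wide (P : {poly int}) n : (size P <= n)%N ->
  poly_length P = \sum_(i < n) `|P`_i|.
Proof.
by move=> /(@poly_lengthE int P n); rewrite intz => ->; apply: eq_bigr => i _; rewrite intz.
Qed.

Lemma poly_lengthD (P Q : {poly int}) :
  poly_length (P + Q) <= poly_length P + poly_length Q.
Proof.
pose n := maxn (size P) (size Q).
rewrite !(@poly_length_wide _ n) ?leq_maxl ?leq_maxr ?size_polyD // -big_split /=.
by apply: ler_sum => i _; rewrite coefD ler_normD.
Qed.

Lemma poly_length_sum (I : Type) (r : seq I) (f : I -> {poly int}) :
  poly_length (\sum_(i <- r) f i) <= \sum_(i <- r) poly_length (f i).
Proof.
elim: r => [|x r IH]; first by rewrite !big_nil /poly_length size_poly0 big_ord0.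
by rewrite !big_cons; apply: le_trans (poly_lengthD _ _) _; rewrite lerD2l.
Qed.

Lemma poly_length_monomial (c : int) n : poly_length (c *: 'X^n) = `|c|.
Proof.
rewrite (@poly_length_wide _ n.+1); last first.
  by rewrite (leq_trans (size_scale_leq _ _)) ?size_polyXn.
rewrite big_ord_recr /= coefZ coefXn eqxx mulr1 big1 ?add0r // => i _.
by rewrite coefZ coefXn ltn_eqF ?mulr0 ?normr0.
Qed.

(** The minors of [interp_mx] are the values at xi of determinants of this form. *)
Definition monomial_mx N (a n : 'I_N -> 'I_N -> nat) : 'M[{poly int}]_N :=
  \matrix_(k, l) ((a k l)%:R *: 'X^(n k l)).

Lemma monomial_mx_perm N (a n : 'I_N -> 'I_N -> nat) (s : 'S_N) :
  (-1) ^+ s * \prod_k monomial_mx a n k (s k)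
  = ((-1) ^+ s * \prod_k (a k (s k))%:R) *: 'X^(\sum_k n k (s k)).
Proof.
rewrite mulr_signZ -scalerA; congr (_ *: _).
rewrite -prodrXr -scaler_prod; apply: eq_bigr => k _.
by rewrite mxE.
Qed.

Lemma size_monomial_det N (a n : 'I_N -> 'I_N -> nat) H :
  (forall k l, n k l <= H)%N -> (size (\det (monomial_mx a n)) <= (N * H).+1)%N.
Proof.
move=> nH; apply: leq_trans (size_sum _ _ _) _; apply/bigmax_leqP => s _.
rewrite monomial_mx_perm (leq_trans (size_scale_leq _ _)) // size_polyXn ltnS.
apply: (@leq_trans (\sum_(k < N) H)); first exact: leq_sum.
by rewrite sum_nat_const card_ord.
Qed.

Lemma poly_length_monomial_det N (a n : 'I_N -> 'I_N -> nat) K :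
  (forall k l, a k l <= K)%N ->
  poly_length (\det (monomial_mx a n)) <= (N`! * K ^ N)%:R.
Proof.
move=> aK; apply: le_trans (poly_length_sum _ _) _.
apply: (@le_trans _ _ (\sum_(s : 'S_N) (K ^ N)%:R)); last first.
  have cS : #|{: 'S_N}| = N`! by rewrite -card_Sn; apply: eq_card => s; rewrite !inE.
  by rewrite sumr_const cS natrM mulr_natl.
apply: ler_sum => s _; rewrite monomial_mx_perm poly_length_monomial.
rewrite normrM normrX normrN1 expr1n mul1r normr_prod -[N in (K ^ N)%N]card_ord.
rewrite -prod_nat_const natr_prod; apply: ler_prod => k _.
by rewrite normr_ge0 normr_nat ler_nat aK.
Qed.

Lemma liouville_combine (F : numDomainType) (d X p D r W Z : F) (m m' k : nat) :
    1 <= d * X * p ^+ m' * D ^+ k -> 0 <= d -> 0 <= X -> 1 <= p -> 0 <= D ->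
    0 <= r -> X * r <= W -> (m' <= m)%N -> D <= Z ->
  r <= d * W * p ^+ m * Z ^+ k.
Proof.
move=> h d0 X0 p1 D0 r0 XW mm DZ; have p0 : 0 <= p by apply: le_trans p1.
rewrite -[leLHS]mul1r; apply: le_trans (ler_wpM2r r0 h) _.
have -> : d * X * p ^+ m' * D ^+ k * r = d * (X * r) * p ^+ m' * D ^+ k by ring.
apply: ler_pM; rewrite ?mulr_ge0 ?exprn_ge0 //; last by rewrite lerXn2r ?nnegrE ?(le_trans D0).
apply: ler_pM; rewrite ?mulr_ge0 ?exprn_ge0 ?ler_weXn2l //.
by rewrite ler_wpM2l.
Qed.

Lemma liouville_castE (R : realType) (d f Z n m k : nat) (B : R) (z : int) :
  (d%:R * (f%:R * B ^+ n) * z%:~R ^+ m * Z%:R ^+ k)%:C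
  = d%:R * (f%:R * B%:C ^+ n) * z%:~R ^+ m * Z%:R ^+ k :> R[i].
Proof. by rewrite !rmorphM !rmorphXn /= !rmorph_nat rmorph_int. Qed.

(** A nonzero maximal minor is bounded above by its Taylor expansion and below by Liouville. For xi
    this close to e, the two bounds leave an inequality that a good choice of parameters
    violates. *)
Lemma interp_liouville (R : realType) (xi : R[i]) (P : {poly int}) (S q J T : nat)
    (rho : R) (N := (S * q * J)%N) (K := (S ^ (S * q) * (J + q) ^ T)%N) :
    irreducible_poly P -> (map_poly intr P).[xi] = 0 ->
    10 <= rho -> (0 < S)%N -> (0 < J)%N ->
    (forall m, 0 < m -> m <= J -> m * (S * q).-1 < S * (T - m.-1))%N ->
    `|xi - (expR 1)%:C| <= (rho ^- N)%:C ->
  rho ^+ 'C(N, 2) <= (size P).-1%:R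
    * (N`!%:R * (2 * (rho ^+ (S * q + T) * K%:R * expR (rho * (J * S)%:R))) ^+ N)
    * (poly_length P)%:~R ^+ (N * (J * S)) * ((N`! * K ^ N)%:R) ^+ (size P).-2.
Proof.
move=> irrP Px rho10 S0 J0 hST xie.
have rho0 : 0 < rho by lra.
have rho1 : 1 <= rho by lra.
(* Liouville's inequality is applied for |xi| >= 1, which holds since e >= 2 and rho^(-N) <= 1. *)
have xi1 : 1 <= `|xi|.
  have h : (expR 1)%:C <= (rho ^- N)%:C + `|xi|.
    rewrite -(@normc_real R (expR 1)) ?expR_ge0 // -[(expR 1)%:C](subrK xi).
    by apply: le_trans (ler_normD _ _) _; rewrite lerD2r -normrN opprB.
  rewrite -(lerD2l (rho ^- N)%:C); apply: le_trans h.
  rewrite -[1]/(1%:C) -rmorphD lecR /=; have := expR1_ge2 R.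
  have : rho ^- N <= 1 by rewrite invf_le1 ?exprn_ege1 ?exprn_gt0 //; lra.
  lra.
have xi0 : xi != 0 by rewrite -normr_gt0 (lt_le_trans ltr01).
have full := interp_mx_full xi0 hST.
pose f := fullrankfun full; have unitA := fullrowsub_unit full.
pose a (k l : 'I_N) := taylor_coef (f k %/ T) (f k %% T) (l %/ J) (l %% J).
pose n (k l : 'I_N) := (l %% J * (f k %/ T))%N.
have T0 (k : 'I_N) : (0 < T)%N.
  by have := leq_ltn_trans (leq0n _) (ltn_ord (f k)); rewrite muln_gt0 => /andP[].
have sS k : (f k %/ T < S)%N by rewrite ltn_divLR ?(T0 k) // ltn_ord.
have tT k : (f k %% T <= T)%N by rewrite ltnW // ltn_mod (T0 k).
have iM (l : 'I_N) : (l %/ J <= S * q)%N by rewrite ltnW // ltn_divLR // ltn_ord.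
have jJ (l : 'I_N) : (l %% J <= J)%N by rewrite ltnW // ltn_mod.
have aK k l : (a k l <= K)%N.
  by apply: taylor_coef_le; rewrite ?tT ?iM ?jJ ?(ltnW (sS k)) ?addn_gt0 ?J0.
have nJS k l : (n k l <= J * S)%N by rewrite leq_mul // ltnW.
pose D := \det (monomial_mx a n).
have DE : (map_poly intr D).[xi] = \det (rowsub f (interp_mx xi S T (S * q) J)).
  rewrite -[LHS]/(horner_eval xi (map_poly intr D)) /D -!det_map_mx; congr (\det _).
  apply/matrixP => k l; rewrite !mxE /= /horner_eval map_polyZ map_polyXn hornerZ hornerXn.
  by rewrite rmorph_nat.
have D0 : (map_poly intr D).[xi] != 0 by rewrite DE -unitfE -unitmxE.
pose B := 2 * (rho ^+ (S * q + T) * K%:R * expR (rho * (J * S)%:R)).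
have Dbound : `|(map_poly intr D).[xi]| * rho%:C ^+ 'C(N, 2) <= N`!%:R * B%:C ^+ N.
  pose v (m k : 'I_N) := deriv_pow R[i] (f k %/ T) (f k %% T) m.
  pose u (m l : 'I_N) := exp_taylor R[i] (l %/ J) (l %% J) m.
  pose Rm := \matrix_(k, l) ((a k l)%:R * xi ^+ n k l - \sum_m v m k * u m l).
  have -> : (map_poly intr D).[xi] = \det (\matrix_(k, l) (\sum_m v m k * u m l + Rm k l)).
    by rewrite DE; congr (\det _); apply/matrixP => k l; rewrite !mxE addrCA subrr addr0.
  apply: interp_det_bound; first by rewrite -[1]/(1%:C) lecR.
  move=> k l; rewrite mxE.
  apply: le_trans (interp_entry_bound _ _ rho10 (iM l) (tT k) xie) _.
  rewrite lecR ler_pM2l // ler_pM ?mulr_ge0 ?exprn_ge0 ?expR_ge0 ?(ltW rho0) //.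
    by rewrite ler_wpM2l ?exprn_ge0 ?(ltW rho0) // ler_nat; exact: aK.
  by rewrite ler_expR ler_pM2l // ler_nat; exact: nJS.
have := liouville irrP Px D0 xi1.
set lP := (poly_length P)%:~R; set lD := (poly_length D)%:~R => Liou.
have P0 : P != 0 by have [P1 _] := irrP; apply: contraTneq P1 => ->; rewrite size_poly0.
have lP1 : 1 <= lP by rewrite /lP ler1z poly_length_ge1.
have Dn0 : D != 0 by apply: contraNneq D0 => ->; rewrite rmorph0 horner0.
have lD0 : 0 <= lD by rewrite /lD ler0z (le_trans _ (poly_length_ge1 Dn0)).
have lDle : lD <= (N`! * K ^ N)%:R.
  by rewrite /lD -(rmorph_nat (intr : int -> R[i])) ler_int poly_length_monomial_det.
have sD : ((size D).-1 <= N * (J * S))%N.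
  by have := size_monomial_det a nJS; rewrite -/D; case: (size D).
have rC0 : 0 <= rho%:C ^+ 'C(N, 2) by rewrite exprn_ge0 // lecR ltW.
have B0 : 0 <= B by rewrite !mulr_ge0 ?exprn_ge0 ?expR_ge0 // ltW.
have BC0 : 0 <= B%:C by rewrite lecR.
have main : rho%:C ^+ 'C(N, 2) <= (size P).-1%:R * (N`!%:R * B%:C ^+ N)
    * lP ^+ (N * (J * S)) * ((N`! * K ^ N)%:R) ^+ (size P).-2.
  exact: liouville_combine Liou _ _ _ _ _ _ _ _.
by rewrite -lecR rmorphXn /= liouville_castE.
Qed.

(** * Numerical choice of the parameters *)

Lemma fact_leq_exp n : (n`! <= n ^ n)%N.
Proof.
rewrite fact_prod big_add1 /= big_mkord -[X in (_ <= _ ^ X)%N](card_ord n).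
by rewrite -prod_nat_const; apply: leq_prod => i _; exact: ltn_ord.
Qed.

Lemma bin2_real (R : numFieldType) n : (0 < n)%N -> 'C(n, 2)%:R = n%:R * (n%:R - 1) / 2 :> R.
Proof.
move=> n0; have : ('C(n, 2) * 2`! = n * n.-1)%N by rewrite bin_ffact ffactnS ffactn1.
move=> /(congr1 (fun n => n%:R : R)); rewrite !natrM -subn1 natrB // => <-.
by field.
Qed.

(** Both sides are logarithms, with E = ln rho. Divided by N E, the left is at most 61 d^2 q + 30 d
    q plus lower terms, which q >= 10 keeps below 5 d^2 q, against 100 d^2 q from N / 2. *)
Lemma interp_params_exponent (R : realFieldType) (d q l E : R)
    (N := 200 * d ^+ 2 * q) (M := 20 * d * q) (T := 10 * d * (q + 1)) :
    1 <= d -> 10 <= q -> 0 <= l -> 1 <= E -> 200 * (l + d) <= q * E ->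
  E + (N * (4 * E) + N * (E + (((M + T) * E + (M * E + T * (2 * E)))
    + 20 * (l + d) * (200 * d ^+ 2)))) + N * (200 * d ^+ 2) * l
    + (d - 1) * (N * (4 * E) + N * (M * E + T * (2 * E)))
  < N * (N - 1) / 2 * E.
Proof.
move=> d1 q10 l0 E1 xq.
have d0 : 0 <= d by lra.
have dd1 : 1 <= d ^+ 2 by rewrite exprn_ege1.
have dd : d <= d ^+ 2 by rewrite expr2 ler_peMr.
have N1 : 1 <= N by rewrite /N; nra.
have NE : 1 <= N * E by nra.
have x_le : (20 * (l + d) + l) * (200 * d ^+ 2) <= 21 * d ^+ 2 * q * E.
  have : (20 * (l + d) + l) * 200 <= 21 * (q * E) by lra.
  by move=> /(ler_wpM2r (ltW (lt_le_trans ltr01 dd1))); lra.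
have main : 6 + 2 * M + 3 * T + 21 * d ^+ 2 * q + (d - 1) * (4 + M + 2 * T) < (N - 1) / 2.
  have p1 : d * q <= d ^+ 2 * q by rewrite ler_wpM2r //; lra.
  have p2 : 10 * d ^+ 2 <= d ^+ 2 * q by nra.
  have -> : (d - 1) * (4 + M + 2 * T) = 4 * d - 4 + 40 * (d ^+ 2 * q) + 20 * d ^+ 2
      - 40 * (d * q) - 20 * d by rewrite /M /T; ring.
  rewrite /N /M /T; lra.
have lhs : E + (N * (4 * E) + N * (E + (((M + T) * E + (M * E + T * (2 * E)))
    + 20 * (l + d) * (200 * d ^+ 2)))) + N * (200 * d ^+ 2) * l
    + (d - 1) * (N * (4 * E) + N * (M * E + T * (2 * E)))
  = E + N * E * (5 + 2 * M + 3 * T + (d - 1) * (4 + M + 2 * T))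
    + N * ((20 * (l + d) + l) * (200 * d ^+ 2)) by ring.
rewrite lhs.
have h1 : N * ((20 * (l + d) + l) * (200 * d ^+ 2)) <= N * (21 * d ^+ 2 * q * E).
  by rewrite ler_wpM2l //; lra.
have h2 : E <= N * E by nra.
have h3 := main; rewrite -(ltr_pM2l (lt_le_trans ltr01 NE)) in h3.
have -> : N * (N - 1) / 2 * E = N * E * ((N - 1) / 2) by ring.
apply: le_lt_trans h3; lra.
Qed.

(* Parameters of the determinant for rho = e^E = 20 (l + d): the size N is of
   order d^2 (l + d) / E, so that rho^N is e^(O(d^2 (l + d))). *)
Lemma interp_params_bound (R : realType) (d q : nat) (l lP E : R)
    (S := (20 * d)%N) (J := (10 * d)%N) (T := (J * q.+1)%N) (N := (S * q * J)%N)
    (K := (S ^ (S * q) * (J + q) ^ T)%N) :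
    (0 < d)%N -> 0 <= l -> expR E = 20 * (l + d%:R) -> 200 * (l + d%:R) <= q%:R * E ->
    q%:R <= 200 * (l + d%:R) / E + 1 -> 0 <= lP -> lP <= expR l ->
  d%:R * (N`!%:R * (2 * (expR E ^+ (S * q + T) * K%:R * expR (expR E * (J * S)%:R))) ^+ N)
    * lP ^+ (N * (J * S)) * ((N`! * K ^ N)%:R) ^+ d.-1 < expR E ^+ 'C(N, 2).
Proof.
move=> d0 l0 rhoE qlo qhi lP0 lPl.
have d1 : 1 <= d%:R :> R by rewrite ler1n.
have [x xE] : exists x, x = l + d%:R by exists (l + d%:R).
have x1 : 1 <= x by lra.
have dx : d%:R <= x by lra.
have E1 : 1 <= E by rewrite -ler_expR; have := expR1_le4 R; lra.
have Erho : E <= 20 * x - 1 by have := expR_ge1Dx E; lra.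
(* As E < 20 x, the lower bound 200 x for q E excludes q < 10. *)
have q10 : 10 <= q%:R :> R.
  rewrite leNgt; apply/negP => q9.
  have : q%:R * E <= 10 * (20 * x - 1) by apply: ler_pM; rewrite ?ler0n //; lra.
  lra.
have qx : q%:R <= 201 * x.
  apply: le_trans qhi _; have : 200 * (l + d%:R) / E <= 200 * x.
    have E0 : 0 < E by lra.
    rewrite (ler_pdivrMr _ _ E0) -xE; apply: ler_peMr; lra.
  lra.
have d_le : d%:R <= expR E by lra.
have SE : S%:R = 20 * d%:R :> R by rewrite natrM.
have JE : J%:R = 10 * d%:R :> R by rewrite natrM.
have NE : N%:R = 200 * d%:R ^+ 2 * q%:R :> R by rewrite /N natrM natrM SE JE; ring.
have TE : T%:R = 10 * d%:R * (q%:R + 1) :> R by rewrite /T natrM JE -[q.+1%:R]natr1.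
(* With rho = 20 x: S = 20 d is at most rho, J + q <= 211 x at most rho^2, and N <= 200 * 201 x^3 at
   most rho^4. *)
have S_le : S%:R <= expR E by lra.
have V_le : (J + q)%:R <= expR (2 * E).
  rewrite (expRM_natl 2) rhoE -xE natrD JE.
  have : x <= x ^+ 2 by rewrite expr2 ler_peMr //; lra.
  have -> : (20 * x) ^+ 2 = 400 * x ^+ 2 by ring.
  lra.
have N_le : N%:R <= expR (4 * E).
  rewrite (expRM_natl 4) rhoE -xE NE.
  have dd : d%:R ^+ 2 <= x ^+ 2 by rewrite lerXn2r ?nnegrE //; lra.
  have ddq : d%:R ^+ 2 * q%:R <= x ^+ 2 * (201 * x) by apply: ler_pM; rewrite ?exprn_ge0.
  have x34 : x ^+ 3 <= x ^+ 4 by rewrite ler_weXn2l.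
  have -> : (20 * x) ^+ 4 = 400 * (400 * x ^+ 4) by ring.
  have x30 : 0 <= x ^+ 3 by rewrite exprn_ge0 //; lra.
  have x3 : x ^+ 2 * (201 * x) = 201 * x ^+ 3 by ring.
  lra.
have two_le : 2 <= expR E by lra.
have fact_le : N`!%:R <= expR (N%:R * (4 * E)).
  rewrite expRM_natl; apply: (@le_trans _ _ (N ^ N)%:R); first by rewrite ler_nat fact_leq_exp.
  by rewrite natrX lerXn2r ?nnegrE ?expR_ge0.
have K_le : K%:R <= expR ((S * q)%:R * E + T%:R * (2 * E)).
  rewrite expRD /K natrM !natrX (expRM_natl (S * q)) (expRM_natl T).
  by apply: ler_pM; rewrite ?exprn_ge0 // lerXn2r ?nnegrE ?expR_ge0.
have MTE : (S * q + T)%:R = 20 * d%:R * q%:R + 10 * d%:R * (q%:R + 1) :> R.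
  by rewrite natrD natrM SE TE.
have ME : (S * q)%:R = 20 * d%:R * q%:R :> R by rewrite natrM SE.
have JSE : (J * S)%:R = 200 * d%:R ^+ 2 :> R by rewrite natrM JE SE; ring.
have q0 : (0 < q)%N by rewrite -(ltr_nat R); lra.
have N0 : (0 < N)%N by rewrite /N /S /J !muln_gt0 d0 q0.
have CE := bin2_real R N0.
move: (S * q)%N (J * S)%N MTE ME JSE K_le => M JS MTE ME JSE K_le.
clearbody N K T S J; clear V_le S_le.
pose B := E + (((M + T)%:R * E + (M%:R * E + T%:R * (2 * E))) + expR E * JS%:R).
set b := 2 * _.
have b0 : 0 <= b by rewrite !mulr_ge0 ?exprn_ge0 ?expR_ge0.
have B_le : b <= expR B.
  rewrite /b /B expRD ler_pM // ?mulr_ge0 ?exprn_ge0 ?expR_ge0 //.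
  rewrite expRD ler_wpM2r ?expR_ge0 // expRD expRM_natl ler_wpM2l ?exprn_ge0 ?expR_ge0 //.
have tot : d%:R * (N`!%:R * b ^+ N) * lP ^+ (N * JS) * ((N`! * K ^ N)%:R) ^+ d.-1
  <= expR (E + (N%:R * (4 * E) + N%:R * B) + (N * JS)%:R * l
     + (d.-1)%:R * (N%:R * (4 * E) + N%:R * (M%:R * E + T%:R * (2 * E)))).
  rewrite !expRD (expRM_natl N B) (expRM_natl (N * JS) l) (expRM_natl d.-1).
  apply: ler_pM; rewrite ?mulr_ge0 ?exprn_ge0 //.
    apply: ler_pM; rewrite ?mulr_ge0 ?exprn_ge0 //.
      apply: ler_pM; rewrite ?mulr_ge0 ?exprn_ge0 //.
      apply: ler_pM; rewrite ?mulr_ge0 ?exprn_ge0 //.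
      by rewrite lerXn2r ?nnegrE ?expR_ge0.
    by rewrite lerXn2r ?nnegrE ?expR_ge0.
  rewrite lerXn2r ?nnegrE ?expR_ge0 // natrM natrX expRD ler_pM ?exprn_ge0 //.
  by rewrite (expRM_natl N (_ + _)) lerXn2r ?nnegrE ?expR_ge0.
apply: le_lt_trans tot _.
rewrite -expRM_natl ltr_expR CE natrM -subn1 natrB //.
rewrite /B rhoE MTE ME JSE NE TE.
exact: interp_params_exponent.
Qed.

(** Since T = J q + J and m - 1 < J, more than J q orders remain at each of the [S] points, while m
    S q <= J S q. *)
Lemma interp_params_zeros (S q J m : nat) : (0 < S)%N -> (0 < m)%N -> (m <= J)%N ->
  (m * (S * q).-1 < S * (J * q.+1 - m.-1))%N.
Proof.
move=> S0 m0 mJ; apply: leq_ltn_trans (leq_mul mJ (leq_pred _)) _.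
rewrite mulnCA ltn_pmul2l // mulnS.
by set Jq := (J * q)%N; lia.
Qed.

Lemma expR1_approx_root (R : realType) (xi : R[i]) (P : {poly int}) (L : R)
    (d := (size P).-1) :
    irreducible_poly P -> (map_poly intr P).[xi] = 0 ->
    1 <= L -> (poly_length P)%:~R <= L ->
  (expR (- (44 * 10 ^+ 3 * d%:R ^+ 2 * (ln L + d%:R))))%:C <= `|xi - (expR 1)%:C|.
Proof.
move=> irrP Px L1 PL; have [P1 _] := irrP.
have d0 : (0 < d)%N by rewrite /d -subn1 subn_gt0.
have d1 : 1 <= d%:R :> R by rewrite ler1n.
have l0 : 0 <= ln L by rewrite ln_ge0.
have [l lE] : exists l, l = ln L by eexists.
have Ll : L = expR l by rewrite lE lnK // posrE (lt_le_trans ltr01).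
rewrite -lE in l0 *.
have rho20 : 20 <= 20 * (l + d%:R) by lra.
have [E rhoE] : exists E, expR E = 20 * (l + d%:R).
  by exists (ln (20 * (l + d%:R))); rewrite lnK // posrE; lra.
have E1 : 1 <= E by rewrite -ler_expR; have := expR1_le4 R; lra.
have E0 : 0 < E by lra.
have Erho : E <= 20 * (l + d%:R) by have := expR_ge1Dx E; lra.
(* [q] is the integer part of 200 (l + d) / E plus 1. *)
have [q [qlo qhi]] : exists q : nat,
    200 * (l + d%:R) <= q%:R * E /\ q%:R <= 200 * (l + d%:R) / E + 1.
  have z0 : 0 <= 200 * (l + d%:R) / E by apply: divr_ge0; lra.
  have /andP[lo hi] := truncn_itv z0; exists (Num.trunc (200 * (l + d%:R) / E)).+1.
  split; first by rewrite -ler_pdivrMr // ltW.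
  by rewrite -natr1 lerD2r.
pose S := (20 * d)%N; pose J := (10 * d)%N; pose T := (J * q.+1)%N.
pose N := (S * q * J)%N.
rewrite real_leNgt ?normr_real //; last first.
  by rewrite realE lecR expR_ge0.
apply/negP => near.
have lP0 : 0 <= (poly_length P)%:~R :> R.
  by rewrite ler0z /poly_length sumr_ge0.
have := interp_params_bound d0 l0 rhoE qlo qhi lP0; rewrite -Ll => /(_ PL).
rewrite ltNge => /negP; apply.
have S0 : (0 < S)%N by rewrite muln_gt0.
have J0 : (0 < J)%N by rewrite muln_gt0.
apply: (interp_liouville irrP Px _ S0 J0).
- by rewrite rhoE; lra.
- by move=> m m0 mJ; exact: interp_params_zeros.
apply: le_trans (ltW near) _; rewrite lecR -expRM_natl -expRN ler_expR lerN2.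
have -> : (S * q * J)%:R = 200 * d%:R ^+ 2 * q%:R :> R by rewrite /S /J !natrM; ring.
(* From q E <= 200 (l + d) + E <= 220 (l + d) and N = 200 d^2 q comes the constant 200 * 220 = 44 *
   10^3. *)
have : q%:R * E <= 220 * (l + d%:R).
  have -> : 220 * (l + d%:R) = (200 * (l + d%:R) / E) * E + 20 * (l + d%:R).
    by rewrite mulfVK ?gt_eqF //; ring.
  have := ler_wpM2r (ltW E0) qhi; lra.
move=> /(ler_wpM2l (_ : 0 <= 200 * d%:R ^+ 2)) h.
have : 0 <= 200 * d%:R ^+ 2 :> R by apply: mulr_ge0; rewrite ?ler0n ?exprn_ge0.
move=> /h; lra.
Qed.

(** * Values of integer polynomials at e *)

Lemma nearest_root (C : numDomainType) (e r0 : C) (rs : seq C) :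
  exists2 x, x \in r0 :: rs & forall r, r \in r0 :: rs -> `|e - x| <= `|e - r|.
Proof.
elim: rs r0 => [|r1 rs IH] r0.
  by exists r0; rewrite ?mem_head // => r; rewrite inE => /eqP ->.
have [x xin xmin] := IH r1.
have [le|/ltW le] := real_leP (normr_real (e - r0)) (normr_real (e - x)).
  exists r0; first exact: mem_head.
  move=> r; rewrite inE => /orP[/eqP -> //|/xmin]; exact: le_trans.
exists x; first by rewrite inE xin orbT.
by move=> r; rewrite inE => /orP[/eqP -> //|/xmin].
Qed.

Lemma size_deriv_int (P : {poly int}) : size P^`() = (size P).-1.
Proof.
apply/eqP; rewrite eqn_leq; apply/andP; split.
  have [->|P0] := eqVneq P 0; first by rewrite linear0 size_poly0.
  by rewrite -ltnS prednK ?size_poly_gt0 // lt_size_deriv.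
case sP : (size P) => [|[|n]] //=; apply: contraT; rewrite -leqNgt => h.
have := coef_deriv P n; rewrite nth_default // => /esym/eqP.
rewrite mulrn_eq0 /= -[n.+1]/((n.+2).-1) -sP -lead_coefE lead_coef_eq0 => /eqP P0.
by move: sP; rewrite P0 size_poly0.
Qed.

(** If the resultant of [P] and P' vanished, [P] would divide a nonzero polynomial of smaller
    degree. The nonzero resultant is u P + v P', so P' cannot vanish at a root of [P]. *)
Lemma irreducible_simple_root (F : numFieldType) (P : {poly int}) (x : F) :
  irreducible_poly P -> (map_poly intr P).[x] = 0 -> (map_poly intr P^`()).[x] != 0.
Proof.
move=> irrP Px; have [P1 irr] := irrP.
have sdP := size_deriv_int P.
have dP0 : P^`() != 0 by rewrite -size_poly_gt0 sdP -subn1 subn_gt0.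
(* In degree 1 the derivative is a nonzero constant; the Bezout relation below is for nonconstant
   polynomials. *)
have [dP1|dP1] := leqP (size P^`()) 1.
  rewrite (size1_polyC dP1) map_polyC hornerC intr_eq0.
  by move: dP0; rewrite {1}(size1_polyC dP1) polyC_eq0.
have res0 : resultant P P^`() != 0.
  rewrite resultant_eq0 -leqNgt leq_eqVlt; apply/orP; left.
  apply: contraT => /irr /(_ (dvdp_gcdl _ _)) /eqp_dvdl e.
  have := dvdp_gcdr P P^`(); rewrite e => /dvdp_leq -/(_ dP0).
  by rewrite sdP leqNgt ltn_predL (ltn_trans _ P1).
have [[u v] /= _ /(congr1 (fun p => (map_poly (intr : int -> F) p).[x]))] :=
  resultant_in_ideal P1 dP1.
rewrite map_polyC hornerC rmorphD !rmorphM hornerD !hornerM Px mulr0 add0r => e.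
apply: contraNneq res0 => dPx; move/eqP: e.
by rewrite /= dPx mulr0 intr_eq0.
Qed.

Lemma poly_length_deriv (P : {poly int}) :
  poly_length P^`() <= (size P).-1%:R * poly_length P.
Proof.
rewrite (@poly_length_wide _ (size P).-1) ?size_deriv_int //.
rewrite (poly_length_wide (leqSpred (size P))) big_ord_recl mulrDr.
apply: ler_wpDl; first by rewrite mulr_ge0.
rewrite mulr_sumr; apply: ler_sum => i _.
rewrite coef_deriv normrMn -[leLHS]mulr_natl ler_wpM2r // ler_nat.
exact: ltn_ord.
Qed.

Lemma poly_length_ge0 (P : {poly int}) : 0 <= poly_length P.
Proof. by rewrite /poly_length sumr_ge0. Qed.

Lemma intpoly_evalC (R : realType) (P : {poly int}) (x : R) :
  (intpoly_eval P x)%:C = (map_poly intr P).[x%:C].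
Proof.
rewrite /intpoly_eval -horner_map /= -map_poly_comp; congr (_.[_]).
by apply: eq_map_poly => z /=; rewrite rmorph_int.
Qed.

(* With x the root nearest to e, each other root r satisfies
   |x - r| <= 2 |e - r|, so |P(e)| is at least |e - x| |P'(x)| / 2^(d-1). *)
Lemma nearest_root_deriv (C : numClosedFieldType) (P : {poly int}) (e : C) : (1 < size P)%N ->
  exists x, (map_poly intr P).[x] = 0 /\
    (1 <= `|(map_poly intr P).[e]| \/
     `|x - e| <= 1 /\ `|x - e| * `|(map_poly intr P^`()).[x]|
       <= 2 ^+ (size P).-2 * `|(map_poly intr P).[e]|).
Proof.
move=> P1; pose p := map_poly intr P : {poly C}.
have P0 : P != 0 by apply: contraTneq P1 => ->; rewrite size_poly0.
have sp : size p = size P by rewrite size_map_inj_poly ?rmorph0 //; exact: intr_inj.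
have [rs0 pE] := closed_field_poly_normal p.
have p0 : lead_coef p != 0 by rewrite lead_coef_eq0 -size_poly_eq0 sp size_poly_eq0.
have srs : size rs0 = (size P).-1.
  by rewrite -sp pE size_scale ?size_prod_XsubC.
case rsE : rs0 => [|r0 rs]; first by move: srs P1; rewrite rsE /=; case: (size P) => [|[|n]].
have [x xin xmin] := nearest_root e r0 rs; rewrite -rsE in xin xmin.
have perm := perm_to_rem xin; set ss := rem x rs0 in perm.
have sss : size ss = (size P).-2 by rewrite size_rem // srs.
have pE2 : p = ('X - x%:P) * (lead_coef p *: \prod_(r <- ss) ('X - r%:P)).
  by rewrite {1}pE (perm_big _ perm) big_cons /= scalerAr.
set q := _ *: _ in pE2.
exists x; rewrite -/p; split; first by rewrite pE2 hornerM hornerXsubC subrr mul0r.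
have qE y : `|q.[y]| = `|lead_coef p| * \prod_(r <- ss) `|y - r|.
  rewrite /q hornerZ normrM horner_prod normr_prod; congr (_ * _).
  by apply: eq_bigr => r _; rewrite hornerXsubC.
have a1 : 1 <= `|lead_coef p|.
  rewrite lead_coef_map_inj ?rmorph0 //; last exact: intr_inj.
  by rewrite -intr_norm -[1]/(1%:~R) ler_int -gtz0_ge1 normr_gt0 lead_coef_eq0.
have ss_rs r : r \in ss -> r \in rs0 by move/mem_rem.
have pe : `|p.[e]| = `|x - e| * `|q.[e]|.
  by rewrite {1}pE2 hornerM hornerXsubC normrM distrC.
(* If the nearest root is at distance at least 1 from e, then all |e - r| are at least 1, and so is
   the leading coefficient. *)
have [xe|/ltW xe] := real_leP (normr_real (x - e)) (real1 C); last first.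
  left; rewrite pe mulr_ege1 // qE mulr_ege1 //.
  rewrite big_seq; elim/big_ind: _ => // [a b|r /ss_rs /xmin]; first exact: mulr_ege1.
  by apply: le_trans; rewrite distrC.
right; split=> //.
have -> : (map_poly intr P^`()).[x] = q.[x].
  rewrite -deriv_map -/p pE2 derivM derivXsubC mul1r hornerD hornerM.
  by rewrite hornerXsubC subrr mul0r addr0.
rewrite pe mulrCA ler_wpM2l // !qE mulrCA ler_wpM2l // -sss.
elim: (ss) ss_rs => [_|r l IH h]; first by rewrite !big_nil mulr1.
rewrite !big_cons /= exprS mulrACA.
apply: ler_pM; rewrite ?prodr_ge0 //; last by apply: IH => z zl; rewrite h // inE zl orbT.
apply: le_trans (ler_distD e x r) _; rewrite mulrDl mul1r lerD2r distrC.
by apply: xmin; rewrite h ?mem_head.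
Qed.

Lemma ler_expRX (R : realType) (x y : R) n :
  0 <= x -> x <= expR y -> x ^+ n <= expR (n%:R * y).
Proof. by move=> x0 xy; rewrite expRM_natl lerXn2r ?nnegrE ?expR_ge0. Qed.

Lemma natr_le_expR (R : realType) n : n%:R <= expR n%:R :> R.
Proof. by apply: le_trans (expR_ge1Dx _); rewrite lerDr. Qed.

(** The roots being simple, Liouville's inequality bounds |P'(x)| from below at the root x nearest
    to e; with the lower bound for |x - e| this bounds |P(e)|. Passing from 44 to 45 covers the
    extra exponent of order d (l + d). *)
Lemma irreducible_value_expR1 (R : realType) (P : {poly int}) (L : R)
    (d := (size P).-1) :
    irreducible_poly P -> 1 <= L -> (poly_length P)%:~R <= L ->
  expR (- (45 * 10 ^+ 3 * d%:R ^+ 2 * (ln L + d%:R))) <= `|intpoly_eval P (expR 1)|.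
Proof.
move=> irrP L1 PL; have [P1 _] := irrP.
have d0 : (0 < d)%N by rewrite /d -subn1 subn_gt0.
have d1 : 1 <= d%:R :> R by rewrite ler1n.
have l0 : 0 <= ln L by rewrite ln_ge0.
have [l lE] : exists l, l = ln L by eexists.
have Ll : L = expR l by rewrite lE lnK // posrE (lt_le_trans ltr01).
have dd : d%:R <= d%:R ^+ 2 :> R by rewrite expr2 ler_peMr //; lra.
rewrite -lE in l0 *.
have [x [Px]] := nearest_root_deriv (expR 1 : R)%:C P1.
rewrite -intpoly_evalC normc_def /= expr0n addr0 sqrtr_sqr.
set v := `|intpoly_eval P _|; case=> [v1|[xe h]].
  rewrite -[1]/(1%:C) lecR in v1; apply: le_trans v1.
  rewrite -[leRHS]expR0 ler_expR oppr_le0 !mulr_ge0 ?exprn_ge0 //; lra.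
have xi1 : 1 <= `|x|.
  have h1 : (expR 1)%:C <= 1 + `|x|.
    rewrite -(@normc_real R (expR 1)) ?expR_ge0 // -[(expR 1)%:C](subrK x).
    by apply: le_trans (ler_normD _ _) _; rewrite lerD2r distrC.
  rewrite -(lerD2l 1); apply: le_trans h1.
  by rewrite -[1]/(1%:C) -rmorphD lecR; exact: expR1_ge2.
have Liou := liouville irrP Px (irreducible_simple_root irrP Px) xi1.
have near := expR1_approx_root irrP Px L1 PL; rewrite -lE -/d in near.
set w := `|(map_poly intr P^`()).[x]| in h Liou.
have wR : w = (complex.Re w)%:C by rewrite RRe_real // normr_real.
move: (complex.Re w) wR => u uE; rewrite uE in h Liou.
have u0 : 0 <= u by rewrite -ler0c -uE; exact: normr_ge0.
have {near} h2 : expR (- (44 * 10 ^+ 3 * d%:R ^+ 2 * (l + d%:R))) * u <= 2 ^+ d.-1 * v.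
  rewrite -lecR; apply: le_trans (_ : `|x - (expR 1)%:C| * u%:C <= _).
    by rewrite rmorphM ler_wpM2r // lecR.
  by apply: le_trans h _; rewrite rmorphM rmorphXn /= natc.
have {Liou} h3 : 1 <= d%:R * u * (poly_length P)%:~R ^+ d.-1
    * (poly_length P^`())%:~R ^+ d.-1 :> R.
  move: Liou; rewrite size_deriv_int -/d -lecR.
  by rewrite !rmorphM !rmorphXn /= rmorph_nat !rmorph_int.
have lP0 : 0 <= (poly_length P)%:~R :> R by rewrite ler0z poly_length_ge0.
have lP'0 : 0 <= (poly_length P^`())%:~R :> R by rewrite ler0z poly_length_ge0.
have lP'le : (poly_length P^`())%:~R <= expR (d%:R + l).
  rewrite expRD -Ll; apply: le_trans (ler_pM _ _ (natr_le_expR R d) PL) => //.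
  by rewrite -(rmorph_nat (intr : int -> R)) -rmorphM ler_int poly_length_deriv.
(* [W] collects the factors d, L(P)^(d-1) and L(P')^(d-1) of Liouville's inequality, with L(P') <= d
   L(P) <= e^(d + l). *)
pose W : R := d%:R + d.-1%:R * l + d.-1%:R * (d%:R + l).
have h4 : 1 <= u * expR W.
  apply: le_trans h3 _; rewrite [d%:R * u]mulrC -!mulrA ler_wpM2l // /W !expRD !mulrA.
  apply: ler_pM; rewrite ?mulr_ge0 ?exprn_ge0 //; last exact: ler_expRX.
  apply: ler_pM; rewrite ?exprn_ge0 //; first exact: natr_le_expR.
  by apply: ler_expRX => //; rewrite -Ll.
have h5 : expR (- W) <= u by rewrite expRN -[leLHS]mul1r ler_pdivrMr ?expR_gt0.
have h6 : (2 : R) ^+ d.-1 <= expR d%:R.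
  apply: le_trans (_ : expR 1 ^+ d.-1 <= _).
    by rewrite lerXn2r ?nnegrE ?expR_ge0 ?expR1_ge2.
  by rewrite -expRM_natl mulr1 ler_expR ler_nat leq_pred.
have v0 : 0 <= v by exact: normr_ge0.
have h7 := le_trans (ler_wpM2l (expR_ge0 _) h5) (le_trans h2 (ler_wpM2r v0 h6)).
rewrite -(ler_pM2l (expR_gt0 d%:R)); apply: le_trans h7.
rewrite -!expRD ler_expR /W -subn1 natrB //.
have p1 : d%:R * l <= d%:R ^+ 2 * l by rewrite ler_wpM2r.
have p2 : d%:R ^+ 2 <= d%:R ^+ 2 * d%:R :> R by rewrite ler_peMr ?exprn_ge0.
have p3 : 0 <= d%:R ^+ 2 * l by rewrite mulr_ge0 ?exprn_ge0.
lra.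
Qed.

Lemma irreducible_factor (Q : {poly int}) : (1 < size Q)%N ->
  exists A B : {poly int}, irreducible_poly A /\ Q = A * B.
Proof.
have [n] := ubnP (size Q); elim: n Q => // n IH Q Qn Q1.
have [irrQ|] := pselect (irreducible_poly Q).
  by exists Q, 1; rewrite mulr1.
move=> red; have [r [r1 rQ rnQ]] : exists r : {poly int},
    [/\ size r != 1%N, r %| Q & ~~ (r %= Q)].
  apply: contrapT => no; apply: red; split=> // r r1 rQ; apply: contrapT => /negP rnQ.
  by apply: no; exists r.
have [s Qs] := dvdpP_int rQ.
have Q0 : Q != 0 by apply: contraTneq Q1 => ->; rewrite size_poly0.
have r0 : r != 0 by apply: contraNneq Q0 => r0; move: rQ; rewrite r0 dvd0p.
have sr : (size r < size Q)%N.
  by rewrite ltn_neqAle dvdp_leq // andbT dvdp_size_eqp.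
have [||A [B [irrA E]]] := IH (zprimitive r); rewrite ?size_zprimitive.
- exact: leq_trans sr _.
- by rewrite ltn_neqAle eq_sym r1 size_poly_gt0.
by exists A, (B * s); split; rewrite // mulrA -E.
Qed.

Lemma intpoly_evalM (R : realType) (P Q : {poly int}) (x : R) :
  intpoly_eval (P * Q) x = intpoly_eval P x * intpoly_eval Q x.
Proof. by rewrite /intpoly_eval rmorphM hornerM. Qed.

Lemma ln_pow2M_le (R : realType) n (L : R) : 1 <= L -> ln (2 ^+ n * L) <= n%:R + ln L.
Proof.
move=> L1; have L0 : 0 < L by lra.
rewrite lnM ?posrE ?exprn_gt0 // lerD2r -ler_expR lnK ?posrE ?exprn_gt0 //.
rewrite -[n%:R]mulr1 expRM_natl lerXn2r ?nnegrE ?expR_ge0 //; exact: expR1_ge2.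
Qed.

(** Induction on the divisors [Q] of a fixed [P], splitting off an irreducible factor [A]. The
    length of [A] is compared with that of [P] itself, so powers of 2 do not pile up, and an
    exponent linear in deg Q adds up over the factors. *)
Lemma divisor_value_expR1 (R : realType) (P : {poly int}) (D : nat) (L : R) :
    P != 0 -> ((size P).-1 <= D)%N -> 1 <= L -> (poly_length P)%:~R <= L ->
  forall Q B, P = Q * B ->
  expR (- (90 * 10 ^+ 3 * (size Q).-1%:R * D%:R * (ln L + D%:R)))
    <= `|intpoly_eval Q (expR 1)|.
Proof.
move=> P0 PD L1 PL Q; have [n] := ubnP (size Q); elim: n Q => // n IH Q Qn B PE.
have /andP[Q0 B0] : (Q != 0) && (B != 0) by rewrite -negb_or -mulf_eq0 -PE.
have l0 : 0 <= ln L by rewrite ln_ge0.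
have [Q1|Q1] := leqP (size Q) 1.
  have -> : (size Q).-1 = 0%N by move: Q1; case: (size Q) => [|[]].
  rewrite mulr0 !mul0r oppr0 expR0 (size1_polyC Q1) /intpoly_eval map_polyC hornerC.
  rewrite /= -intr_norm -[1]/(1%:~R) ler_int -gtz0_ge1 normr_gt0.
  by move: Q0; rewrite {1}(size1_polyC Q1) polyC_eq0.
have [A [C [irrA QE]]] := irreducible_factor Q1; have [A1 _] := irrA.
have /andP[A0 C0] : (A != 0) && (C != 0) by rewrite -negb_or -mulf_eq0 -QE.
have sA : (0 < size A)%N by rewrite size_poly_gt0.
have sC : (0 < size C)%N by rewrite size_poly_gt0.
have sB : (0 < size B)%N by rewrite size_poly_gt0.
have sQ : size Q = (size A + size C).-1 by rewrite QE size_mul.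
have sP : size P = (size Q + size B).-1 by rewrite PE size_mul.
have PA : P = A * (C * B) by rewrite PE QE mulrA.
have hC : expR (- (90 * 10 ^+ 3 * (size C).-1%:R * D%:R * (ln L + D%:R)))
    <= `|intpoly_eval C (expR 1)|.
  apply: (IH C _ (A * B)); last by rewrite PA mulrCA.
  clear -Qn sQ A1 sC.
  by move: (size Q) (size A) (size C) Qn sQ A1 sC => *; lia.
have AL : (poly_length A)%:~R <= 2 ^+ (size A).-1 * L.
  have : poly_length A <= 2 ^+ (size A).-1 * poly_length P.
    rewrite PA -(ler_int R[i]) rmorphM rmorphXn /=.
    by apply: poly_length_factor; rewrite -PA.
  rewrite -(ler_int R) rmorphM rmorphXn /= => /le_trans; apply.
  by rewrite ler_wpM2l ?exprn_ge0.
have pow1 : 1 <= 2 ^+ (size A).-1 * L by rewrite mulr_ege1 // exprn_ege1 // ler1n.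
have hA := irreducible_value_expR1 irrA pow1 AL.
have lnA := ln_pow2M_le (size A).-1 L1.
have sQE : (size Q).-1%:R = (size A).-1%:R + (size C).-1%:R :> R.
  rewrite -natrD sQ; congr (_%:R).
  by case: (size A) sA => // a _; rewrite addSn /= -subn1 -addnBA // subn1.
have aD : (size A).-1%:R <= D%:R :> R.
  rewrite ler_nat; clear -PD sP sQ sC sB.
  by move: (size P) (size Q) (size A) (size B) (size C) PD sP sQ sC sB => *; lia.
rewrite sQE QE intpoly_evalM normrM.
apply: le_trans (ler_pM (expR_ge0 _) (expR_ge0 _) hA hC).
rewrite -expRD ler_expR; move: lnA aD l0 (ler0n R (size A).-1) (ln_ge0 pow1).
move: (ln (_ * L)) (ln L) ((size A).-1%:R) (D%:R) ((size C).-1%:R)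
  => lA l a D' c lnA aD l0 a0 lA0.
(* With a = deg A, ln(2^a L) + a <= 2 a + ln L <= 2 (ln L + D), which doubles 45 to 90. *)
have : a * a * (lA + a) <= a * D' * (2 * (l + D')).
  apply: ler_pM; rewrite ?mulr_ge0 ?addr_ge0 //; [by rewrite ler_wpM2l|lra].
by rewrite expr2; lra.
Qed.

Theorem theorem4 (R : realType) :
  (forall (xi L : R),
      algebraicOver (ratr : rat -> R) xi ->
      3 <= L ->
      (alg_length xi)%:~R <= L ->
      expR (- (76 * 10 ^+ 3 * (alg_degree xi)%:R ^+ 2
               * (ln L + (alg_degree xi)%:R)))
        <= `|expR 1 - xi|)
  /\
  (forall (d : nat) (L : R) (P : {poly int}),
      (1 <= d)%N ->
      3 <= L ->
      P != 0 ->
      ((size P).-1 <= d)%N ->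
      (poly_length P)%:~R <= L ->
      expR (- (13 / 10 * 10 ^+ 5 * d%:R ^+ 2 * (ln L + d%:R)))
        <= `|intpoly_eval P (expR 1)|).
Proof.
split=> [xi L alg_xi L3 lenL|d L P d1 L3 P0 Pd PL].
  have [irrP _ Pxi] := int_minpolyP alg_xi.
  have L1 : 1 <= L by lra.
  have Pxi0 : (map_poly intr (int_minpoly xi)).[xi%:C] = 0.
    by rewrite -intpoly_evalC Pxi.
  have := expR1_approx_root irrP Pxi0 L1 lenL.
  rewrite -rmorphB normc_def /= expr0n addr0 sqrtr_sqr lecR distrC; apply: le_trans.
  have X0 : 0 <= (alg_degree xi)%:R ^+ 2 * (ln L + (alg_degree xi)%:R).
    by rewrite mulr_ge0 ?exprn_ge0 ?addr_ge0 ?ln_ge0.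
  rewrite ler_expR lerN2 -!mulrA in X0 *; lra.
have L1 : 1 <= L by lra.
have l0 : 0 <= ln L by rewrite ln_ge0.
(* The case [Q = P], [B = 1]; the constant 90 * 10^3 is below 1.3 * 10^5. *)
have := divisor_value_expR1 P0 Pd L1 PL (esym (mulr1 P)); apply: le_trans.
rewrite ler_expR lerN2.
have X0 : 0 <= d%:R ^+ 2 * (ln L + d%:R) by rewrite mulr_ge0 ?exprn_ge0 ?addr_ge0.
have : (size P).-1%:R * (d%:R * (ln L + d%:R)) <= d%:R * (d%:R * (ln L + d%:R)).
  by rewrite ler_wpM2r ?mulr_ge0 ?addr_ge0 // ler_nat.
by rewrite [leRHS]mulrA -expr2 => X1; lra.
Qed.
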